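(* For $\tau>0$, the functional $\mathcal L_0^\tau$ on $W^{1,2}_{x_\pm}([0,1],\mathbb R^n)$ has a minimizer, and the minimizer $x$ satisfies the Euler–Lagrange equation $$\frac{d}{dt}\partial_vL(x(t),\dot x(t)/\tau)=\tau\,\partial_xL(x(t),\dot x(t)/\tau).$$
   Context: Let $\sigma>0$ and let $V:\mathbb R^n\to\mathbb R$ satisfy: (1) $V$ is of class $C^4$; (2) $U(x):=\sigma\Delta V(x)-\frac12|\nabla V(x)|^2$ is bounded from above and its maximum points are contained in a bounded domain; (3) $V$ has two local minimizers $x_0,x_1$ with $\nabla V(x_0)=\nabla V(x_1)=0$ and $\Delta V(x_0)>0$, $\Delta V(x_1)>0$. Put $L(x,v)=\frac12|v|^2-U(x)$. Fix $x_-,x_+\in\mathbb R^n$ and let $W^{1,2}_{x_\pm}([0,1],\mathbb R^n)=\{x\in W^{1,2}([0,1],\mathbb R^n): x(0)=x_-,\ x(1)=x_+\}$. For $\tau>0$ let $$\mathcal L_0^\tau(x)=\tau\int_0^1 L(x(t),\dot x(t)/\tau)\,dt .$$ *)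

(* Defs.v *)
From mathcomp Require Import all_boot all_order all_algebra.
From mathcomp Require Import all_classical all_reals all_analysis.

Set Implicit Arguments.
Unset Strict Implicit.
Unset Printing Implicit Defensive.

Import Order.TTheory GRing.Theory Num.Theory.
Import numFieldNormedType.Exports.

Local Open Scope classical_set_scope.
Local Open Scope ring_scope.

Section Euclidean.
Context {R : realType} {n : nat}.
Implicit Types (f : 'rV[R]_n -> R) (v x : 'rV[R]_n).

(* The library norm on 'rV[R]_n is the sup norm, so the squared Euclidean norm
   is written out. *)
Definition sqnorm v : R := \sum_(i < n) v 0 i ^+ 2.

Definition partial (i : 'I_n) f : 'rV[R]_n -> R := fun x => 'D_(delta_mx 0 i) f x.

Definition grad f x : 'rV[R]_n := \row_(i < n) partial i f x.

Definition laplacian f x : R := \sum_(i < n) partial i (partial i f) x.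

(* All iterated partial derivatives of order at most k exist everywhere and are
   continuous. *)
Fixpoint class_C (k : nat) f : Prop :=
  match k with
  | 0 => continuous f
  | k'.+1 => continuous f /\
      forall i : 'I_n,
        (forall x, derivable f x (delta_mx 0 i)) /\ class_C k' (partial i f)
  end.

Definition local_minimizer f x : Prop := \forall y \near x, f x <= f y.

Definition max_points f : set 'rV[R]_n := [set x | forall y, f y <= f x].

Definition bounded_domain (D : set 'rV[R]_n) : Prop :=
  [/\ D !=set0, open D, connected D & bounded_set D].

End Euclidean.

Section Sobolev.
Context {R : realType} {n : nat}.

Definition L2_01 (f : R -> R) : Prop :=
  f \_ `[0, 1]%classic \in Lfun (@lebesgue_measure R) 2%:E.

(* C^1 functions with compact support in the open interval ]0, 1[ (the closure
   of the support is bounded, hence compact). *)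
Definition test_function (phi : R -> R) : Prop :=
  [/\ forall t, derivable phi t 1,
      continuous (derive1 phi) &
      closure [set t | phi t != 0] `<=` `]0, 1[%classic].

Definition weak_derivative (f g : R -> R) : Prop :=
  forall phi, test_function phi ->
    \int[@lebesgue_measure R]_(t in `[0, 1]) (f t * derive1 phi t) =
    - \int[@lebesgue_measure R]_(t in `[0, 1]) (g t * phi t).

Definition L2_weak_derivative (x v : R -> 'rV[R]_n) : Prop :=
  forall i : 'I_n, L2_01 (fun t => v t 0 i) /\
    weak_derivative (fun t => x t 0 i) (fun t => v t 0 i).

(* W^{1,2}([0, 1], R^n). A class is represented by its continuous
   representative, so that boundary values make sense. Curves are functions on
   R of which only the values on [0, 1] matter. *)
Definition W12 (x : R -> 'rV[R]_n) : Prop :=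
  [/\ {within `[0, 1], continuous x},
      forall i : 'I_n, L2_01 (fun t => x t 0 i) &
      exists v, L2_weak_derivative x v].

Definition W12_bc (xm xp : 'rV[R]_n) : set (R -> 'rV[R]_n) :=
  [set x | [/\ W12 x, x 0 = xm & x 1 = xp]].

(* A choice of weak derivative (unique up to a null set); the zero function if
   there is none. *)
Definition wderiv (x : R -> 'rV[R]_n) : R -> 'rV[R]_n :=
  xget (fun=> 0) [set v | L2_weak_derivative x v].

End Sobolev.

Section Action.
Context {R : realType} {n : nat}.
Implicit Types (L : 'rV[R]_n -> 'rV[R]_n -> R) (x : R -> 'rV[R]_n) (tau : R).

Definition potentialU (sigma : R) (V : 'rV[R]_n -> R) (x : 'rV[R]_n) : R :=
  sigma * laplacian V x - 2^-1 * sqnorm (grad V x).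

Definition lagrangian (sigma : R) (V : 'rV[R]_n -> R) (x v : 'rV[R]_n) : R :=
  2^-1 * sqnorm v - potentialU sigma V x.

Definition action L tau x : R :=
  tau * \int[@lebesgue_measure R]_(t in `[0, 1])
          L (x t) (tau^-1 *: wderiv x t).

Definition minimizer_on (T : Type) (A : set T) (F : T -> R) (a : T) : Prop :=
  A a /\ forall b, A b -> F a <= F b.

Definition partial_x L (x v : 'rV[R]_n) : 'rV[R]_n := grad (fun y => L y v) x.

Definition partial_v L (x v : 'rV[R]_n) : 'rV[R]_n := grad (fun w => L x w) v.

(* Classical form: derive1 x is the pointwise derivative, asserted to exist on
   ]0, 1[, and so is the outer d/dt. *)
Definition euler_lagrange L tau x : Prop :=
  forall t : R, 0 < t < 1 ->
    derivable x t 1 /\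
    is_derive t 1
      (fun s : R => partial_v L (x s) (tau^-1 *: derive1 x s))
      (tau *: partial_x L (x t) (tau^-1 *: derive1 x t)).

End Action.

(* Main.v *)
Require Import Defs.
From mathcomp Require Import all_boot all_order all_algebra.
From mathcomp Require Import all_classical all_reals all_analysis.
From mathcomp Require Import measurable_realfun.
From mathcomp Require Import ring lra.

(** Existence is proved by the direct method.  Since the potential is bounded
above, the action controls the kinetic energy ([action_coercive]); hence a minimizing sequence is bounded and equicontinuous
([energy_modulus]) and, by compactness along an ultrafilter, a subsequence
converges uniformly to a continuous curve x.  Nothing is known yet about the limit
of the velocities; they are eliminated by testing almost-minimality with the Green
functions of the second derivative,

  green t u = (u - t)_+ - u (1 - t),

which vanish at 0 and 1.  The velocity enters the corresponding first variation
only through its integral against the two-valued function green t ', that is,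
through the positions at the times 0, t and 1.  So pointwise convergence of the
curves suffices to pass to the limit ([variation_ge0]), and dividing by the size
of the variation gives, for every t in [0, 1],

  int_0^1 partial_i U (x u) green t u du = tau^-2 chord x t i

([green_equation]), where chord is the deviation of x t from the segment joining
the end points.  The left-hand side is twice differentiable in t, so x is of
class C^2 and satisfies Newton's equation x'' = - tau^2 grad U (x)
([limit_solves_newton]): regularity comes before minimality.  With the C^1
velocity p of x at hand, v^2 >= 2 v p - p^2 and an integration by parts of v p
give the lower semicontinuity of the energy along the sequence, so that x is a
minimizer ([limit_minimizer]).

The same equation, for the constant sequence equal to a given minimizer, gives
the Euler-Lagrange equation ([minimizer_euler_lagrange]).

The weak derivatives are handled by one formula, the fundamental lemma of the
calculus of variations in integrated form ([weak_FTC]): if f is continuous with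
integrable weak derivative g, then f 1 - f t = int_t^1 g.  It gives integration
by parts, and, with the Lebesgue differentiation theorem, the uniqueness almost
everywhere of weak derivatives, so that the action can be computed from any of
them ([action_mechanical]). *)

Set Implicit Arguments.
Unset Strict Implicit.
Unset Printing Implicit Defensive.

Import Order.TTheory GRing.Theory Num.Theory.
Import numFieldNormedType.Exports.

Local Open Scope classical_set_scope.
Local Open Scope ring_scope.

(** * Integrable and square integrable functions on the unit interval *)

Section SquareIntegrable.
Context {R : realType}.
Notation mu := (@lebesgue_measure R).
Notation I01 := (`[0%R : R, 1%R]%classic).
Implicit Types f g h : R -> R.

Definition int01 f : Prop := mu.-integrable I01 (EFin \o f).

Definition sqint01 f : Prop :=
  measurable_fun I01 f /\ int01 (fun t => f t ^+ 2).

Lemma mI01 : measurable (I01 : set (measurableTypeR R)).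
Proof. exact: measurable_itv. Qed.

Lemma fin_I01 : (mu I01 < +oo)%E.
Proof. by rewrite lebesgue_measure_itv/= lte01 sube0 ltry. Qed.

Lemma int01_meas f : int01 f -> measurable_fun I01 f.
Proof. by move/(measurable_int mu)/measurable_EFinP. Qed.

Lemma int01_le f g : measurable_fun I01 f -> int01 g ->
  (forall t, I01 t -> `|f t| <= g t) -> int01 f.
Proof.
move=> mf ig fg; apply: le_integrable ig => //; first exact/measurable_EFinP.
move=> t It /=; rewrite lee_fin (le_trans (fg t It))//.
exact: ler_norm.
Qed.

Lemma int01_bounded f (M : R) : measurable_fun I01 f ->
  (forall t, I01 t -> `|f t| <= M) -> int01 f.
Proof.
move=> mf fM; apply: (int01_le mf (g := cst M)) => //.
apply: measurable_bounded_integrable => //; first exact: fin_I01.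
by exists `|M|; split; rewrite ?num_real// => y My t _ /=; exact: ltW.
Qed.

Lemma int01_cont f : {within I01, continuous f} -> int01 f.
Proof.
by move=> cf; apply: continuous_compact_integrable => //; exact: segment_compact.
Qed.

Lemma int01_cst (c : R) : int01 (cst c).
Proof. by apply: int01_cont => ?; exact: cvg_cst. Qed.

Lemma eq_int01 f g : (forall t, I01 t -> f t = g t) -> int01 f -> int01 g.
Proof.
move=> fg; apply: eq_integrable => // t; rewrite inE => It /=.
by rewrite fg.
Qed.

Lemma int01D f g : int01 f -> int01 g -> int01 (fun t => f t + g t).
Proof. by move=> If Ig; exact: (integrableD mI01 If Ig). Qed.

Lemma int01Z (c : R) f : int01 f -> int01 (fun t => c * f t).
Proof. by move=> If; exact: (integrableZl mI01 c If). Qed.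

Lemma int01B f g : int01 f -> int01 g -> int01 (fun t => f t - g t).
Proof. by move=> If Ig; exact: (integrableB mI01 If Ig). Qed.

Lemma int01_abs f : int01 f -> int01 (fun t => `|f t|).
Proof. by move=> If; exact: (integrable_norm If). Qed.

Lemma int01_sum n (f : 'I_n -> R -> R) : (forall i, int01 (f i)) ->
  int01 (fun t => \sum_i f i t).
Proof.
move=> If; rewrite /int01 (_ : _ \o _ = fun t => \sum_i (f i t)%:E)%E.
  by apply: (integrable_sum mI01) => i _; exact: If.
by apply/funext => t /=; rewrite sumEFin.
Qed.

(** Young's inequality |f g| <= f^2 + g^2 dominates the product. *)
Lemma sqint01_mul f g : sqint01 f -> sqint01 g -> int01 (fun t => f t * g t).
Proof.
move=> [mf f2] [mg g2]; apply: (int01_le _ (int01D f2 g2)).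
  exact: measurable_funM.
by move=> t _; rewrite ler_norml; nra.
Qed.

Lemma sqint01_bounded f (M : R) : measurable_fun I01 f ->
  (forall t, I01 t -> `|f t| <= M) -> sqint01 f.
Proof.
move=> mf fM; split => //; apply: (@int01_bounded _ (M ^+ 2)).
  exact: measurable_funX.
move=> t It; rewrite normrX; apply: lerXn2r; rewrite ?nnegrE//; last exact: fM.
exact: le_trans (fM _ It).
Qed.

Lemma sqint01_cont f : {within I01, continuous f} -> sqint01 f.
Proof.
move=> cf; split; first by apply: int01_meas; exact: int01_cont.
by apply: int01_cont => t; apply: continuousM; exact: cf.
Qed.

Lemma sqint01_cst (c : R) : sqint01 (cst c).
Proof. by apply: sqint01_cont => ?; exact: cvg_cst. Qed.

Lemma sqint01_int f : sqint01 f -> int01 f.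
Proof.
move=> sf; apply: eq_int01 (sqint01_mul sf (sqint01_cst 1)) => t _.
by rewrite mulr1.
Qed.

Lemma sqint01D f g : sqint01 f -> sqint01 g -> sqint01 (fun t => f t + g t).
Proof.
move=> sf sg; split; first exact: measurable_funD sf.1 sg.1.
have := int01D (int01D sf.2 sg.2) (int01Z 2 (sqint01_mul sf sg)).
by apply: eq_int01 => t _; ring.
Qed.

Lemma sqint01Z (c : R) f : sqint01 f -> sqint01 (fun t => c * f t).
Proof.
move=> sf; split; first exact: measurable_funM (measurable_cst _) sf.1.
by apply: eq_int01 (int01Z (c ^+ 2) sf.2) => t _; ring.
Qed.

(** Membership in L^2 as measurability and integrability of the square, a form
that is stable under the algebra of integrands used below. *)
Lemma L2_01P f : L2_01 f <-> sqint01 f.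
Proof.
have sqE (g : R -> R) : (fun t => (g \_ I01) t ^+ 2) = (fun t => g t ^+ 2) \_ I01.
  by apply/funext => t; rewrite !patchE; case: ifP => // _; rewrite expr0n.
split => [fL|[mf f2]].
  have mf : measurable_fun I01 f.
    apply/(measurable_restrictT f mI01).
    by case/andP : (fL); rewrite inE.
  split => //; apply/(integrable_mkcond _ mI01).
  by rewrite restrict_EFin -sqE; exact: Lfun2_integrable_sqr.
have mf0 : measurable_fun setT (f \_ I01) by apply/(measurable_restrictT f mI01).
rewrite /L2_01; apply/andP; split; rewrite inE//= /finite_norm unlock.
apply: poweR_lty.
move/(integrable_mkcond _ mI01) : f2; rewrite restrict_EFin -sqE.
move=> /integrableP[_]; congr (_ < _)%E; apply: eq_integral => t _.
by rewrite /= normrX -powR_mulrn.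
Qed.

Lemma Int_D f g : int01 f -> int01 g ->
  \int[mu]_(t in I01) (f t + g t) =
  \int[mu]_(t in I01) f t + \int[mu]_(t in I01) g t.
Proof. by move=> ? ?; rewrite RintegralD//; exact: mI01. Qed.

Lemma Int_B f g : int01 f -> int01 g ->
  \int[mu]_(t in I01) (f t - g t) =
  \int[mu]_(t in I01) f t - \int[mu]_(t in I01) g t.
Proof. by move=> ? ?; rewrite RintegralB//; exact: mI01. Qed.

Lemma Int_Z (c : R) f : int01 f ->
  \int[mu]_(t in I01) (c * f t) = c * \int[mu]_(t in I01) f t.
Proof. by move=> ?; rewrite RintegralZl//; exact: mI01. Qed.

Lemma Int_cst (c : R) : \int[mu]_(t in I01) c = c.
Proof.
by rewrite Rintegral_cst//= lebesgue_measure_itv/= lte01 sube0 mulr1.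
Qed.

Lemma eq_Int f g : (forall t, I01 t -> f t = g t) ->
  \int[mu]_(t in I01) f t = \int[mu]_(t in I01) g t.
Proof. by move=> fg; apply: eq_Rintegral => t; rewrite inE => /fg. Qed.

Lemma le_Int f g : int01 f -> int01 g -> (forall t, I01 t -> f t <= g t) ->
  \int[mu]_(t in I01) f t <= \int[mu]_(t in I01) g t.
Proof. by move=> ? ? ?; apply: le_Rintegral. Qed.

Lemma Int_abs f : int01 f ->
  `|\int[mu]_(t in I01) f t| <= \int[mu]_(t in I01) `|f t|.
Proof. by move=> ?; apply: le_normr_Rintegral. Qed.

Lemma Int_sum n (f : 'I_n -> R -> R) : (forall i, int01 (f i)) ->
  \int[mu]_(t in I01) (\sum_i f i t) = \sum_i \int[mu]_(t in I01) f i t.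
Proof.
elim: n f => [|n IH] f If.
  rewrite big_ord0 -[RHS](Int_cst 0); apply: eq_Int => t _.
  by rewrite big_ord0.
rewrite big_ord_recl -IH// -Int_D//; last exact: int01_sum.
by apply: eq_Int => t _; rewrite big_ord_recl.
Qed.

(** Integrals over subintervals of [0, 1] are written as integrals over [0, 1]
against this indicator, so that a single domain of integration is used. *)
Definition after (t u : R) : R := (t < u)%R%:R.

Lemma meas_after (t : R) (D : set R) : measurable_fun D (after t).
Proof.
rewrite (_ : after t = \1_(`]t, +oo[%classic : set R)).
  exact: measurable_indic.
apply/funext => u; rewrite /after indicE; congr (_%:R).
by rewrite mem_setE in_itv/= andbT.
Qed.

Lemma after_ge0 (t u : R) : 0 <= after t u. Proof. exact: ler0n. Qed.

Lemma after_le1 (t u : R) : after t u <= 1.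
Proof. by rewrite /after; case: (t < u). Qed.

Lemma int01_after (t : R) f : int01 f -> int01 (fun u => after t u * f u).
Proof.
move=> If; apply: int01_le (int01_abs If) _.
  by apply: measurable_funM; [exact: meas_after|exact: int01_meas].
move=> u _; rewrite normrM ger0_norm ?after_ge0//.
by rewrite -[leRHS]mul1r ler_wpM2r// after_le1.
Qed.

Lemma sqint01_after t : sqint01 (after t).
Proof.
apply: (@sqint01_bounded _ 1); first exact: meas_after.
by move=> u _; rewrite ger0_norm ?after_ge0 ?after_le1.
Qed.

Lemma Int_oo f : int01 f ->
  \int[mu]_(u in `]0%R, 1%R[) f u = \int[mu]_(u in I01) f u.
Proof.
move=> If.
rewrite Rintegral_itv_bndo_bndc ?Rintegral_itv_obnd_cbnd//.
  by apply: integrableS If => //; apply: subset_itv; rewrite bnd_simp.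
by apply: integrableS If => //; apply: subset_itv; rewrite bnd_simp.
Qed.

(** The end points are negligible. *)
Lemma eq_Int_oo f g : int01 f -> int01 g ->
  (forall t, 0 < t < 1 -> f t = g t) ->
  \int[mu]_(t in I01) f t = \int[mu]_(t in I01) g t.
Proof.
move=> If Ig fg; rewrite -!Int_oo//; apply: eq_Rintegral => t.
by rewrite inE/= in_itv/= => /fg.
Qed.

Lemma Int_after0 f : int01 f ->
  \int[mu]_(u in I01) (after 0 u * f u) = \int[mu]_(u in I01) f u.
Proof.
move=> If; apply: eq_Int_oo => //; first exact: int01_after.
by move=> t /andP[t0 _]; rewrite /after t0 mul1r.
Qed.

(** Dominated convergence for finite integrals; the limit inherits
measurability and integrability from the sequence. *)
Lemma Int_dominated (f_ : nat -> R -> R) f g :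
  (forall k, measurable_fun I01 (f_ k)) -> int01 g ->
  (forall k t, I01 t -> `|f_ k t| <= g t) ->
  (forall t, I01 t -> f_ k t @[k --> \oo] --> f t) ->
  int01 f /\
  \int[mu]_(t in I01) f_ k t @[k --> \oo] --> \int[mu]_(t in I01) f t.
Proof.
move=> mf ig fg ff.
have mf_ k : measurable_fun I01 (EFin \o f_ k) by exact/measurable_EFinP.
have ff' t : I01 t -> (f_ k t)%:E @[k --> \oo] --> (f t)%:E.
  by move=> It; apply: cvg_EFin; [exact: nearW|exact: ff].
have fg' k t : I01 t -> (`|(f_ k t)%:E| <= (g t)%:E)%E.
  by move=> It; rewrite lee_fin; exact: fg.
have gfin t : I01 t -> (g t)%:E \is a fin_num by [].
have mf0 : measurable_fun I01 f.
  by apply/measurable_EFinP; exact: (emeasurable_fun_cvg _ _ mf_ ff').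
have If : int01 f.
  apply: int01_le ig _ => // t It.
  apply: (cvgr_to_le (cvg_norm (ff _ It))).
  by apply: nearW => k; exact: fg.
split => //.
apply: fine_cvg; rewrite fineK; last exact: integrable_fin_num.
have := dominated_cvg mI01 mf_ ff' gfin ig fg'.
by [].
Qed.

End SquareIntegrable.

(** * Explicit test functions of class C^1 *)

Section SmoothStep.
Context {R : realType}.
Implicit Types s t u d : R.
Notation mu := (@lebesgue_measure R).
Notation I01 := (`[0%R : R, 1%R]%classic).

(** The square of the positive part is of class C^1, with derivative twice the
positive part.  The second difference of one half of it, [sstep], is then a C^1
step from 0 to 1 on [0, 2] whose derivative is the tent function: this gives
explicit test functions. *)
Definition posq u : R := Num.max 0 u ^+ 2.

Lemma is_derive_posq u : is_derive u 1 posq (2 * Num.max 0 u).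
Proof.
have [u0|u0|u0] := ltgtP u 0.
- rewrite mulr0.
  apply: (@near_eq_is_derive _ _ _ (cst 0)).
  near=> x; rewrite /posq (max_idPl _) ?expr0n//=.
  by apply: ltW; near: x; exact: lt_nbhsl.
- apply: (@near_eq_is_derive _ _ _ (fun x : R => x ^+ 2)); last first.
    by apply: is_derive_eq; rewrite /GRing.scale/= !mulr1; ring.
  near=> x; rewrite /posq (max_idPr _)//.
  by apply: ltW; near: x; exact: lt_nbhsr.
rewrite u0 mulr0.
have H : (fun h : R => h^-1 *: (posq (h *: 1 + 0) - posq 0)) @ 0^' --> (0 : R).
  apply/cvgrPdist_le => e e0; near=> h.
  have h0 : h != 0 by near: h; exact: nbhs_dnbhs_neq.
  have he : `|h| < e by near: h; exact: dnbhs0_lt.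
  rewrite sub0r normrN /posq addr0 maxxx expr0n/= subr0 /GRing.scale/= mulr1.
  have [h0'|h0'] := leP h 0.
    by rewrite expr0n/= mulr0 normr0 ltW.
  by rewrite expr2 mulrA mulVf// mul1r ltW.
split; first by apply/cvg_ex; exists 0; exact: H.
exact: (cvg_lim _ H).
Unshelve. all: by end_near. Qed.

Definition sstep u : R := (posq u - 2 * posq (u - 1) + posq (u - 2)) / 2.

Definition tent u : R :=
  Num.max 0 u - 2 * Num.max 0 (u - 1) + Num.max 0 (u - 2).

Lemma is_derive_comp1 (F : R -> R) (a c u dF : R) :
  is_derive (a * (u - c)) 1 F dF ->
  is_derive u 1 (fun x => F (a * (x - c))) (a * dF).
Proof.
move=> dF'.
have dl : is_derive u (1 : R) (fun x : R => a * (x - c)) a.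
  by apply: is_derive_eq; rewrite /GRing.scale/= subr0 mulr1.
rewrite mulrC.
exact: (is_derive1_comp (f := F) (g := fun x : R => a * (x - c))).
Qed.

Lemma is_derive_sstep u : is_derive u 1 sstep (tent u).
Proof.
have d1 : is_derive u (1 : R) (fun x => posq (x - 1)) (2 * Num.max 0 (u - 1)).
  have := @is_derive_comp1 posq 1 1 u _ (is_derive_posq _).
  by rewrite !mul1r; under eq_fun do rewrite mul1r.
have d2 : is_derive u (1 : R) (fun x => posq (x - 2)) (2 * Num.max 0 (u - 2)).
  have := @is_derive_comp1 posq 1 2 u _ (is_derive_posq _).
  by rewrite !mul1r; under eq_fun do rewrite mul1r.
have d0 := is_derive_posq u.
rewrite /sstep; apply: is_derive_eq.
by rewrite /tent /GRing.scale/= ?scaler0 ?mulr0 ?addr0; field.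
Qed.

Lemma continuous_tent : continuous tent.
Proof.
have c (a : R) : continuous (fun x : R => Num.max 0 (x - a)).
  move=> x; apply: (@continuous_max R R (cst 0) (fun x => x - a)) => //; first exact: cst_continuous.
  by move=> ?; apply: cvgB => //; exact: cvg_cst.
move=> x; apply: cvgD; first apply: cvgB.
- by have := c 0 x; under eq_fun do rewrite subr0; exact.
- by apply: cvgMr; exact: c.
- exact: c.
Qed.

Lemma tent_ge0 u : 0 <= tent u.
Proof. by rewrite /tent /Num.max; do !case: ifP; lra. Qed.

Lemma tent_out u : u <= 0 \/ 2 <= u -> tent u = 0.
Proof. by rewrite /tent /Num.max; do !case: ifP; lra. Qed.

Lemma sstep_le0 u : u <= 0 -> sstep u = 0.
Proof. by rewrite /sstep /posq /Num.max; do !case: ifP; nra. Qed.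

Lemma sstep_ge2 u : 2 <= u -> sstep u = 1.
Proof. by rewrite /sstep /posq /Num.max; do !case: ifP; nra. Qed.

Lemma sstep01 u : 0 <= sstep u <= 1.
Proof.
by apply/andP; rewrite /sstep /posq /Num.max; do !case: ifP; split; nra.
Qed.

(** A C^1 step that rises from 0 at s to 1 at s + 2 d. *)
Definition ramp d s u : R := sstep (d^-1 * (u - s)).
Definition dramp d s u : R := d^-1 * tent (d^-1 * (u - s)).

Lemma is_derive_ramp d s u : is_derive u 1 (ramp d s) (dramp d s u).
Proof. exact/is_derive_comp1/is_derive_sstep. Qed.

Lemma continuous_dramp d s : continuous (dramp d s).
Proof.
move=> u; apply: cvgMr.
apply: (@continuous_comp _ _ _ (fun u => d^-1 * (u - s)) tent); last exact: continuous_tent.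
by apply: cvgMr; apply: cvgB => //; exact: cvg_cst.
Qed.

Lemma continuous_ramp d s : continuous (ramp d s).
Proof.
move=> u; apply: differentiable_continuous; apply/derivable1_diffP.
by have [] := is_derive_ramp d s u.
Qed.

Lemma ramp01 d s u : 0 <= ramp d s u <= 1. Proof. exact: sstep01. Qed.

Lemma ramp0 d s u : 0 < d -> u <= s -> ramp d s u = 0.
Proof.
by move=> d0 us; apply: sstep_le0; rewrite mulr_ge0_le0 ?invr_ge0 ?subr_le0 // ltW.
Qed.

Lemma ramp1 d s u : 0 < d -> s + 2 * d <= u -> ramp d s u = 1.
Proof.
by move=> d0 us; apply: sstep_ge2; rewrite ler_pdivlMl//; lra.
Qed.

Lemma dramp_ge0 d s u : 0 < d -> 0 <= dramp d s u.
Proof. by move=> d0; rewrite mulr_ge0 ?invr_ge0 ?tent_ge0// ltW. Qed.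

Lemma dramp_out d s u : 0 < d -> u <= s \/ s + 2 * d <= u -> dramp d s u = 0.
Proof.
move=> d0 us; rewrite /dramp tent_out ?mulr0//; case: us => us.
  by left; rewrite mulr_ge0_le0 ?invr_ge0 ?subr_le0 // ltW.
by right; rewrite ler_pdivlMl//; lra.
Qed.

Lemma Int_FTC (F f : R -> R) (a b : R) : a < b ->
  (forall t, is_derive t 1 F (f t)) -> continuous f ->
  \int[mu]_(t in `[a, b]) f t = F b - F a.
Proof.
move=> ab dF cf; rewrite /Rintegral (@continuous_FTC2 _ f F)//.
- by apply: continuous_subspaceT.
- have cF x : {for x, continuous F}.
    apply: differentiable_continuous; apply/derivable1_diffP.
    by have [] := dF x.
  split.
  + by move=> x _; have [] := dF x.
  + exact/cvg_at_right_filter/cF.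
  + exact/cvg_at_left_filter/cF.
- by move=> x _; rewrite derive1E; have [_ ->] := dF x.
Qed.

(** The derivative of the ramp is an approximate unit concentrated at s. *)
Lemma Int_dramp d s : 0 < d -> 0 <= s -> s + 2 * d <= 1 ->
  \int[mu]_(t in I01) dramp d s t = 1.
Proof.
move=> d0 s0 s1; rewrite (Int_FTC ltr01 (is_derive_ramp d s) (@continuous_dramp d s)).
by rewrite ramp1// ramp0// subr0.
Qed.

Lemma test_functionI (phi dphi : R -> R) a b :
  (forall t, is_derive t 1 phi (dphi t)) -> continuous dphi ->
  0 < a -> b < 1 -> (forall t, t < a \/ b < t -> phi t = 0) ->
  test_function phi /\ derive1 phi = dphi.
Proof.
move=> dphiE cdphi a0 b1 supp.
have E : derive1 phi = dphi.
  by apply/funext => t; rewrite derive1E; have [_ ->] := dphiE t.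
split => //; split; last 1 first.
- have : [set t | phi t != 0] `<=` `[a, b]%classic.
    move=> t /= p0; rewrite in_itv/= !leNgt; apply/andP; split; apply: contra p0 => h.
      by rewrite supp//; left.
    by rewrite supp//; right.
  move/(@closure_subset R^o); move/subset_trans; apply.
  apply: subset_trans (_ : `[a, b]%classic `<=` _).
    by rewrite -(closure_id _).1//; exact: itv_closed.
  by apply: subset_itv; rewrite bnd_simp.
- by move=> t; have [] := dphiE t.
- by rewrite E.
Qed.

(** Averages against an approximate unit concentrated in ]s, s + 2 d[ see only
the values of f there. *)
Lemma dramp_mass (f : R -> R) s d (e : R) : {within I01, continuous f} ->
  0 < d -> 0 <= s -> s + 2 * d <= 1 ->
  (forall u, s < u -> u < s + 2 * d -> `|f s - f u| <= e) ->
  `|f s - \int[mu]_(u in I01) (f u * dramp d s u)| <= e.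
Proof.
move=> cf d0 s0 s1 fe.
have Id : int01 (dramp d s).
  by apply: int01_cont; apply: continuous_subspaceT; exact: continuous_dramp.
have Ifd : int01 (fun u => f u * dramp d s u).
  apply: int01_cont => u; apply: continuousM; first exact: cf.
  exact: (continuous_subspaceT (@continuous_dramp d s)).
have -> : f s = \int[mu]_(u in I01) (f s * dramp d s u).
  by rewrite Int_Z// Int_dramp// mulr1.
rewrite -Int_B//; last exact: int01Z.
apply: (le_trans (Int_abs _)); first by apply: int01B => //; exact: int01Z.
have -> : e = \int[mu]_(u in I01) (e * dramp d s u).
  by rewrite Int_Z// Int_dramp// mulr1.
apply: le_Int.
- by apply: int01_abs; apply: int01B => //; exact: int01Z.
- exact: int01Z.
move=> u _; rewrite -mulrBl normrM [`|dramp _ _ _|]ger0_norm ?dramp_ge0//.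
have [h1|h1] := leP u s; first by rewrite dramp_out ?mulr0//; left.
have [h2|h2] := leP (s + 2 * d) u; first by rewrite dramp_out ?mulr0//; right.
by rewrite ler_wpM2r ?dramp_ge0 ?fe.
Qed.

End SmoothStep.

(** * Weak derivatives and increments *)

Section WeakFTC.
Context {R : realType}.
Implicit Types s t u d : R.
Notation mu := (@lebesgue_measure R).
Notation I01 := (`[0%R : R, 1%R]%classic).
Variables (f g : R -> R).
Hypothesis cf : {within I01, continuous f}.
Hypothesis ig : int01 g.
Hypothesis wfg : weak_derivative f g.

Let delta d (k : nat) : R := d / k.+1%:R.

Let delta_gt0 d k : 0 < d -> 0 < delta d k.
Proof. by move=> d0; rewrite divr_gt0// ltr0n. Qed.

Let delta_le d k : 0 < d -> delta d k <= d.
Proof. by move=> d0; rewrite ler_pdivrMr ?ltr0n// ler_peMr ?ler1n// ltW. Qed.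

Let delta_cvg d : delta d k @[k --> \oo] --> (0 : R).
Proof.
rewrite -(mulr0 d); apply: cvgMr.
exact: (@cvg_harmonic R).
Qed.

Lemma cvg_ramp d s u : 0 < d ->
  ramp (delta d k) s u @[k --> \oo] --> after s u.
Proof.
move=> d0; have [us|su] := leP u s.
  rewrite /after ltNge us/=; under eq_fun do rewrite ramp0 ?delta_gt0//.
  exact: cvg_cst.
rewrite /after su; apply: cvg_near_cst.
near=> k; rewrite ramp1 ?delta_gt0//.
have : delta d k <= (u - s) / 2.
  near: k; apply: (cvgr_le _ (@delta_cvg d)); lra.
lra.
Unshelve. all: by end_near. Qed.

Lemma cvg_dramp d s : 0 < d -> 0 <= s -> s + 2 * d <= 1 ->
  \int[mu]_(u in I01) (f u * dramp (delta d k) s u) @[k --> \oo] --> f s.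
Proof.
move=> d0 s0 s1; apply/cvgrPdist_le => e e0.
have Is : I01 s by rewrite /= in_itv/= s0/=; lra.
have := cf; move/subspace_continuousP => /(_ s Is)/cvgrPdist_le/(_ e e0).
move=> [r /= r0 rf].
near=> k.
have dk0 := delta_gt0 k d0.
have dk1 := delta_le k d0.
have dkr : 2 * delta d k <= r.
  rewrite -ler_pdivlMl//.
  near: k; apply: (cvgr_le _ (@delta_cvg d)); lra.
apply: dramp_mass => //; first lra.
move=> u su us; apply: rf => /=.
  by rewrite distrC gtr0_norm; lra.
by rewrite in_itv/=; apply/andP; split; lra.
Unshelve. all: by end_near. Qed.

(** Test the weak derivative with the plateau rising at s and falling at t, of
slopes concentrated on intervals of length going to 0.  The left-hand side of the
defining identity tends to f s - f t because the slopes are approximate units;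
the right-hand side tends to an integral of g by dominated convergence. *)
Lemma weak_FTC_oo s t : 0 < s -> s < t -> t < 1 ->
  f t - f s = \int[mu]_(u in I01) (after s u * g u)
              - \int[mu]_(u in I01) (after t u * g u).
Proof.
move=> s0 st t1.
(* small enough for the fall, which ends at t + 2 d, to stay inside ]0, 1[ *)
pose d := (1 - t) / 4; have d0 : 0 < d by rewrite /d; lra.
pose phi k u := ramp (delta d k) s u - ramp (delta d k) t u.
pose dphi k u := dramp (delta d k) s u - dramp (delta d k) t u.
have test k : test_function (phi k) /\ derive1 (phi k) = dphi k.
  have dk0 := delta_gt0 k d0; have dk1 := delta_le k d0.
  apply: (@test_functionI _ _ _ s (t + 2 * delta d k)) => //.
  - move=> u.
    have := is_derive_ramp (delta d k) s u; have := is_derive_ramp (delta d k) t u.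
    by move=> ? ?; exact: is_deriveB.
  - by move=> u; apply: cvgB; exact: continuous_dramp.
  - by move: dk1; rewrite /d; lra.
  - move=> u [us|ut]; rewrite /phi.
      by rewrite !ramp0 ?subrr//; lra.
    by rewrite !ramp1 ?subrr//; lra.
have E k : \int[mu]_(u in I01) (f u * dramp (delta d k) s u)
           - \int[mu]_(u in I01) (f u * dramp (delta d k) t u)
         = - \int[mu]_(u in I01) (g u * phi k u).
  have [tk dk] := test k.
  rewrite -(wfg tk) dk -Int_B.
  - by apply: eq_Int => u _; rewrite -mulrBr.
  - apply: int01_cont => u; apply: continuousM; first exact: cf.
    by apply: continuous_subspaceT; exact: continuous_dramp.
  - apply: int01_cont => u; apply: continuousM; first exact: cf.
    by apply: continuous_subspaceT; exact: continuous_dramp.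
have L1 : \int[mu]_(u in I01) (f u * dramp (delta d k) s u)
           - \int[mu]_(u in I01) (f u * dramp (delta d k) t u) @[k --> \oo]
         --> f s - f t.
  by apply: cvgB; apply: cvg_dramp => //; rewrite /d; lra.
have mphi k : measurable_fun I01 (phi k).
  apply: int01_meas; apply: int01_cont; apply: continuous_subspaceT => u.
  by apply: cvgB; exact: continuous_ramp.
have bphi k u : `|phi k u| <= 1.
  have := ramp01 (delta d k) s u; have := ramp01 (delta d k) t u.
  by rewrite /phi ler_norml; lra.
have [_ L2] : int01 (fun u => g u * (after s u - after t u)) /\
   \int[mu]_(u in I01) (g u * phi k u) @[k --> \oo] -->
   \int[mu]_(u in I01) (g u * (after s u - after t u)).
  apply: (@Int_dominated _ _ _ (fun u => `|g u|)).
  - by move=> k; apply: measurable_funM => //; exact: int01_meas.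
  - exact: int01_abs.
  - by move=> k u _; rewrite normrM ler_piMr.
  - by move=> u _; apply: cvgMr; apply: cvgB; exact: cvg_ramp.
have L3 : f s - f t = - \int[mu]_(u in I01) (g u * (after s u - after t u)).
  have L2' : (\int[mu]_(u in I01) (f u * dramp (delta d k) s u)
      - \int[mu]_(u in I01) (f u * dramp (delta d k) t u)) @[k --> \oo] -->
    - \int[mu]_(u in I01) (g u * (after s u - after t u)).
    by rewrite (eq_cvg _ _ E); apply: cvgN.
  exact: (cvg_unique (@Rhausdorff R) L1 L2').
rewrite -(opprB (f s)) L3 opprK -Int_B; try exact: int01_after.
by apply: eq_Int => u _; ring.
Qed.

Lemma cvg_seq_within (s_ : nat -> R) s : I01 s ->
  (forall k, I01 (s_ k)) -> s_ k @[k --> \oo] --> s ->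
  f (s_ k) @[k --> \oo] --> f s.
Proof.
move=> Is Isk ss; move/subspace_continuousP : cf => /(_ s Is) h.
apply: cvg_trans h; apply: (cvg_comp s_ f); last exact: cvg_id.
move=> P /= [r r0 rP].
have [N _ HN] := (cvgrPdist_lt _ _).1 ss _ r0.
exists N => // k Nk /=; apply: rP; [exact: HN|exact: Isk].
Qed.

(** The integrands are cut off to ]0, 1[, which does not change the integrals:
when s_ increases to 1, the indicators do not converge at the end point 1. *)
Lemma cvg_Int_after (s_ : nat -> R) s :
  (forall u, 0 < u < 1 -> after (s_ k) u @[k --> \oo] --> after s u) ->
  \int[mu]_(u in I01) (after (s_ k) u * g u) @[k --> \oo] -->
  \int[mu]_(u in I01) (after s u * g u).
Proof.
move=> ss.
(* the indicator of ]0, 1[, on [0, 1] *)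
pose inn (u : R) : R := after 0 u * (1 - after 1 u) * (u != 1)%:R.
have inE u : 0 < u < 1 -> inn u = 1.
  move=> /andP[u0 u1]; rewrite /inn /after u0 ltNge (ltW u1) lt_eqF//=.
  by rewrite subr0 !mulr1.
have out u : I01 u -> 0 < u < 1 \/ inn u = 0.
  rewrite /= in_itv/= => /andP[]; rewrite le_eqVlt => /predU1P[<- _|u0].
    by right; rewrite /inn /after ltxx !mul0r.
  rewrite le_eqVlt => /predU1P[->|u1]; first by right; rewrite /inn eqxx mulr0.
  by left; rewrite u0.
have minn : measurable_fun I01 inn.
  apply: measurable_funM.
    apply: measurable_funM; first exact: meas_after.
    by apply: measurable_funB => //; exact: meas_after.
  rewrite (_ : (fun u => _) = fun u => 1 - \1_([set 1] : set R) u).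
    by apply: measurable_funB => //; exact: measurable_indic.
  apply/funext => u; rewrite indicE; case: (eqVneq u 1) => [->|u1].
    by rewrite mem_set//= subrr.
  by rewrite memNset ?subr0// => /= /eqP; exact/negP.
have E t : \int[mu]_(u in I01) (after t u * g u) =
    \int[mu]_(u in I01) (inn u * (after t u * g u)).
  apply: eq_Int_oo => [||u u01]; last by rewrite inE// mul1r.
    exact: int01_after.
  apply: int01_le (int01_abs (int01_after t ig)) _.
    by apply: measurable_funM => //; apply: int01_meas; exact: int01_after.
  move=> u /out[u01|->]; first by rewrite inE// mul1r.
  by rewrite mul0r normr0.
rewrite E; rewrite (eq_cvg _ _ (fun k => E (s_ k))).
have [||||_ //] := @Int_dominated _ (fun k u => inn u * (after (s_ k) u * g u))
  (fun u => inn u * (after s u * g u)) (fun u => `|g u|).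
- move=> k; apply: measurable_funM => //; apply: int01_meas; exact: int01_after.
- exact: int01_abs.
- move=> k u /out[u01|->]; last by rewrite mul0r normr0.
  by rewrite inE// mul1r normrM ger0_norm ?after_ge0// ler_piMl ?after_le1.
- move=> u /out[u01|->].
    by apply: cvgMr; apply: cvgMl; exact: ss.
  by rewrite mul0r; under eq_fun do rewrite mul0r; exact: cvg_cst.
Qed.

(** The case of interior times extends to the closed interval by continuity of f
and of the integral: first the right end point, then the left one. *)
Lemma weak_FTC t : 0 <= t <= 1 ->
  f 1 - f t = \int[mu]_(u in I01) (after t u * g u).
Proof.
have h0 k : 0 < (k.+2%:R : R)^-1 by rewrite invr_gt0 ltr0n.
have h1 k : (k.+2%:R : R)^-1 <= 2^-1 by rewrite lef_pV2 ?posrE ?ltr0n// ler_nat.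
have hc : (k.+2%:R : R)^-1 @[k --> \oo] --> (0 : R).
  by have := @cvg_harmonic R; rewrite -(@cvg_shiftn 1); under eq_fun do rewrite /= addn1.
have right s : 0 < s < 1 -> f 1 - f s = \int[mu]_(u in I01) (after s u * g u).
  move=> /andP[s0 s1].
  pose t_ k : R := 1 - (1 - s) * k.+2%:R^-1.
  have ts k : s < t_ k.
    rewrite -subr_gt0 /t_ (_ : _ - _ = (1 - s) * (1 - k.+2%:R^-1)); last by ring.
    by rewrite mulr_gt0 ?subr_gt0// (le_lt_trans (h1 k))// invf_lt1 ?ltr1n.
  have t1 k : t_ k < 1 by rewrite /t_ ltrBlDr ltrDl mulr_gt0// subr_gt0.
  have tc : t_ k @[k --> \oo] --> (1 : R).
    rewrite -[X in _ --> X](subr0 1) -[X in _ - X](mulr0 (1 - s)).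
    by apply: cvgB; [exact: cvg_cst|exact: cvgMr].
  have L1 : f (t_ k) - f s @[k --> \oo] --> f 1 - f s.
    apply: cvgB; last exact: cvg_cst.
    apply: cvg_seq_within => //; first by rewrite /= in_itv/= ler01 lexx.
    by move=> k; rewrite /= in_itv/= (ltW (t1 k)) ltW// (lt_trans s0).
  have L2 : f (t_ k) - f s @[k --> \oo] --> \int[mu]_(u in I01) (after s u * g u)
        - \int[mu]_(u in I01) (after 1 u * g u).
    under eq_fun do rewrite (weak_FTC_oo s0 (ts _) (t1 _)).
    apply: cvgB; first exact: cvg_cst.
    apply: cvg_Int_after => u /andP[u0 u1].
    rewrite [after 1 u]/after ltNge (ltW u1)/=; apply: cvg_near_cst.
    near=> k; rewrite /after ltNge (_ : u <= t_ k)//.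
    by near: k; exact: (cvgr_ge _ tc).
  rewrite (cvg_unique (@Rhausdorff R) L1 L2).
  rewrite [X in _ - X](_ : _ = 0) ?subr0//.
  rewrite -[RHS](Int_cst 0); apply: eq_Int => u.
  by rewrite /= in_itv/= => /andP[_ u1]; rewrite /after ltNge u1 mul0r.
move=> /andP[]; rewrite le_eqVlt => /predU1P[<-|t0]; last first.
  rewrite le_eqVlt => /predU1P[->|t1]; last by apply: right; rewrite t0.
  rewrite subrr -[LHS](Int_cst 0); apply: eq_Int => u.
  by rewrite /= in_itv/= => /andP[_ u1]; rewrite /after ltNge u1 mul0r.
move=> _.
have L1 : f 1 - f k.+2%:R^-1 @[k --> \oo] --> f 1 - f 0.
  apply: cvgB; first exact: cvg_cst.
  apply: cvg_seq_within => //; first by rewrite /= in_itv/= ler01 lexx.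
  move=> k; rewrite /= in_itv/= (ltW (h0 k))/= (le_trans (h1 k))// invf_le1// ler1n.
  done.
have L2 : f 1 - f k.+2%:R^-1 @[k --> \oo] --> \int[mu]_(u in I01) (after 0 u * g u).
  have E k : f 1 - f k.+2%:R^-1 = \int[mu]_(u in I01) (after k.+2%:R^-1 u * g u).
    by apply: right; rewrite h0/= invf_lt1 ?ltr1n.
  rewrite (eq_cvg _ _ E).
  apply: cvg_Int_after => u /andP[u0 u1].
  rewrite [after 0 u]/after u0; apply: cvg_near_cst.
  near=> k; rewrite /after (_ : _ < u)//.
  by near: k; exact: (cvgr_lt _ hc).
exact: (cvg_unique (@Rhausdorff R) L1 L2).
Unshelve. all: by end_near. Qed.

End WeakFTC.

(** * Calculus of weak derivatives *)

Section WeakCalculus.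
Context {R : realType}.
Notation mu := (@lebesgue_measure R).
Notation I01 := (`[0%R : R, 1%R]%classic).
Implicit Types (f g h p q : R -> R) (s t u c : R).

Lemma test_function_cont phi : test_function phi ->
  continuous (phi : R -> R).
Proof.
move=> [dphi _ _] x; apply: differentiable_continuous.
exact/derivable1_diffP.
Qed.

Lemma test_function0 phi t : test_function phi -> ~ (0 < t < 1) -> phi t = 0.
Proof.
move=> [_ _ supp] t01; apply/eqP; apply: contra_notT t01 => phit.
have := supp t (@subset_closure _ _ t phit).
by rewrite /= in_itv.
Qed.

Lemma C1_cont p q : (forall t, is_derive t 1 p (q t)) -> continuous p.
Proof.
move=> pq x; apply: differentiable_continuous.
by apply/derivable1_diffP; have [] := pq x.
Qed.

Lemma int01_contT p : continuous p -> int01 p.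
Proof. by move=> cp; apply: int01_cont; exact: continuous_subspaceT. Qed.

Lemma int01_contM f p : {within I01, continuous f} -> continuous p ->
  int01 (fun t => f t * p t).
Proof.
move=> cf cp; apply: int01_cont => t; apply: continuousM; first exact: cf.
exact: continuous_subspaceT.
Qed.

Lemma bounded01 p : {within I01, continuous p} ->
  exists M, forall t, I01 t -> `|p t| <= M.
Proof.
move=> cp; have /compact_bounded[M [_ HM]] := continuous_compact cp (@segment_compact _ 0 1).
exists (M + 1) => t It; apply: HM; first by rewrite ltrDl.
by exists t.
Qed.

Lemma int01_mul_cont g p : int01 g -> {within I01, continuous p} ->
  int01 (fun t => g t * p t).
Proof.
move=> ig cp; have [M HM] := bounded01 cp.
apply: (@int01_le _ _ (fun t => M * `|g t|)).
- apply: measurable_funM; first exact: int01_meas.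
  by apply: int01_meas; exact: int01_cont.
- by apply: int01Z; exact: int01_abs.
- by move=> t It; rewrite normrM mulrC ler_wpM2r// HM.
Qed.

Lemma is_derive_Mtest p q phi t : is_derive t 1 p (q t) -> test_function phi ->
  is_derive t 1 (fun u => p u * phi u) (p t * derive1 phi t + q t * phi t).
Proof.
move=> pqt [dphi _ _].
have dt : is_derive t 1 phi (derive1 phi t).
  by split; [exact: dphi|rewrite derive1E].
by apply: is_derive_eq; rewrite /GRing.scale/= [q t * _]mulrC.
Qed.

(** If phi is a test function, so is p phi; the Leibniz rule for p phi is moved to
f p. *)
Lemma weak_derivative_mul f g p q : {within I01, continuous f} -> int01 g ->
  weak_derivative f g ->
  (forall t, is_derive t 1 p (q t)) -> continuous q ->
  weak_derivative (fun t => f t * p t) (fun t => f t * q t + g t * p t).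
Proof.
move=> cf ig fg pq cq phi tphi.
have cp := C1_cont pq.
have cphi := test_function_cont tphi.
have [dphi cdphi supp] := tphi.
have dE t := is_derive_Mtest (pq t) tphi.
have E : derive1 (fun t => p t * phi t) = fun t => p t * derive1 phi t + q t * phi t.
  by apply/funext => t; rewrite derive1E; have [_ ->] := dE t.
have cpd : continuous (fun t => p t * derive1 phi t).
  by move=> t; apply: continuousM; [exact: cp|exact: cdphi].
have cqd : continuous (fun t => q t * phi t).
  by move=> t; apply: continuousM; [exact: cq|exact: cphi].
have tpphi : test_function (fun t => p t * phi t).
  split.
  - by move=> t; have [] := dE t.
  - by rewrite E => t; apply: cvgD; [exact: cpd|exact: cqd].
  - apply: subset_trans supp; apply: closure_subset => t /=.
    by apply: contra_neq => ->; rewrite mulr0.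
have ip : int01 (fun t => g t * (p t * phi t)).
  apply: int01_mul_cont => //; apply: continuous_subspaceT => t.
  by apply: continuousM; [exact: cp|exact: cphi].
have := fg _ tpphi; rewrite E.
under eq_Rintegral do rewrite mulrDr.
rewrite Int_D; [|exact: int01_contM..].
move=> /eqP; rewrite -subr_eq0 opprK => /eqP H.
rewrite (_ : \int[mu]_(t in I01) (f t * p t * derive1 phi t) =
  \int[mu]_(t in I01) (f t * (p t * derive1 phi t))); last first.
  by apply: eq_Int => t _; rewrite mulrA.
rewrite (_ : \int[mu]_(t in I01) ((f t * q t + g t * p t) * phi t) =
  \int[mu]_(t in I01) (f t * (q t * phi t)) +
  \int[mu]_(t in I01) (g t * (p t * phi t))); last first.
  rewrite -Int_D; [|exact: int01_contM|exact: ip].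
  by apply: eq_Int => t _; ring.
by move: H; lra.
Qed.

(** [weak_FTC] for the product f p, at time 0. *)
Lemma weak_by_parts f g p q : {within I01, continuous f} -> int01 g ->
  weak_derivative f g ->
  (forall t, is_derive t 1 p (q t)) -> continuous q ->
  \int[mu]_(t in I01) (g t * p t) =
  f 1 * p 1 - f 0 * p 0 - \int[mu]_(t in I01) (f t * q t).
Proof.
move=> cf ig fg pq cq.
have cp := C1_cont pq.
have ifq : int01 (fun t => f t * q t) by exact: int01_contM.
have igp : int01 (fun t => g t * p t).
  by apply: int01_mul_cont => //; exact: continuous_subspaceT.
have := weak_FTC _ (int01D ifq igp) (weak_derivative_mul cf ig fg pq cq).
move=> /(_ _ 0); rewrite Int_after0; last exact: int01D.
rewrite Int_D// => ->; first by ring.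
  by move=> t; apply: continuousM; [exact: cf|exact: continuous_subspaceT].
by rewrite lexx ler01.
Qed.

(** The product of p with a test function vanishes at 0 and 1, so its derivative
has integral 0. *)
Lemma weak_derivative_C1 p q : (forall t, is_derive t 1 p (q t)) ->
  continuous q -> weak_derivative p q.
Proof.
move=> pq cq phi tphi.
have cp := C1_cont pq.
have cphi := test_function_cont tphi.
have [dphi cdphi supp] := tphi.
have dE t := is_derive_Mtest (pq t) tphi.
have cpd : continuous (fun t => p t * derive1 phi t).
  by move=> t; apply: continuousM; [exact: cp|exact: cdphi].
have cqd : continuous (fun t => q t * phi t).
  by move=> t; apply: continuousM; [exact: cq|exact: cphi].
have := Int_FTC ltr01 dE; rewrite Int_D; try exact: int01_contT.
rewrite !(test_function0 tphi) ?ltxx ?andbF// !mulr0 subrr.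
move=> /(_ _)/eqP; rewrite addr_eq0 => H; apply/eqP/H.
by move=> t; apply: cvgD; [exact: cpd|exact: cqd].
Qed.

(** The positive part (u - t)_+, in the form that shows its weak derivative. *)
Definition kink t u : R := after t u * (u - t).

Lemma kinkE t u : kink t u = Num.max 0 (u - t).
Proof.
rewrite /kink /after; case: (ltP t u) => tu.
  by rewrite mul1r (max_idPr _)// subr_ge0 ltW.
by rewrite mul0r (max_idPl _)// subr_le0.
Qed.

Lemma continuous_kink t : continuous (kink t).
Proof.
rewrite (_ : kink t = fun u => Num.max 0 (u - t)); last exact/funext/kinkE.
move=> x; apply: (@continuous_max R R (cst 0) (fun x => x - t)) => //.
  exact: cst_continuous.
by move=> ?; apply: cvgB => //; exact: cvg_cst.
Qed.

(** For a test function phi, (u - t) phi u is of class C^1 and vanishes at t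
and 1; applying [weak_FTC] to it at time t is the required identity. *)
Lemma weak_derivative_kink t : 0 <= t <= 1 -> weak_derivative (kink t) (after t).
Proof.
move=> t01 phi tphi.
have cphi := test_function_cont tphi.
have [dphi cdphi supp] := tphi.
have dE u : is_derive u (1:R) (fun u => (u - t) * phi u) ((u - t) * derive1 phi u + phi u).
  have dt : is_derive u 1 phi (derive1 phi u).
    by split; [exact: dphi|rewrite derive1E].
  by apply: is_derive_eq; rewrite /GRing.scale/= subr0 mulr1.
have cl : continuous (fun u => u - t) by move=> u; apply: cvgB => //; exact: cvg_cst.
have c1 : continuous (fun u => (u - t) * derive1 phi u).
  by move=> u; apply: cvgM; [exact: cl|exact: cdphi].
have cd : continuous (fun u => (u - t) * derive1 phi u + phi u).
  by move=> u; apply: cvgD; [exact: c1|exact: cphi].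
have := weak_FTC (continuous_subspaceT (C1_cont dE)) (int01_contT cd)
  (weak_derivative_C1 dE cd) t01.
rewrite subrr mul0r (test_function0 tphi) ?ltxx ?andbF// mulr0 subrr.
under eq_Rintegral do rewrite mulrDr mulrA.
rewrite Int_D.
- by move/eqP; rewrite eq_sym addr_eq0 => /eqP.
- by apply: eq_int01 (int01_after t (int01_contT c1)) => u _; rewrite mulrA.
- by apply: int01_after; exact: int01_contT.
Qed.

Lemma weak_derivativeDZ f1 g1 f2 g2 c : {within I01, continuous f1} ->
  {within I01, continuous f2} -> int01 g1 -> int01 g2 ->
  weak_derivative f1 g1 -> weak_derivative f2 g2 ->
  weak_derivative (fun t => f1 t + c * f2 t) (fun t => g1 t + c * g2 t).
Proof.
move=> cf1 cf2 ig1 ig2 w1 w2 phi tphi.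
have cphi := test_function_cont tphi.
have [dphi cdphi supp] := tphi.
under eq_Rintegral do rewrite mulrDl -mulrA.
rewrite Int_D; [|exact: int01_contM|by apply: int01Z; exact: int01_contM].
rewrite Int_Z ?w1 ?w2//; last exact: int01_contM.
have cp : {within I01, continuous phi} by exact: continuous_subspaceT.
under [in RHS]eq_Rintegral do rewrite mulrDl -mulrA.
rewrite Int_D; [|exact: int01_mul_cont|by apply: int01Z; exact: int01_mul_cont].
by rewrite Int_Z; [ring|exact: int01_mul_cont].
Qed.

(** Extended by 0, the function has a primitive that vanishes identically;
by the Lebesgue differentiation theorem it is almost everywhere the derivative of
this primitive. *)
Lemma int01_after_inj h : int01 h ->
  (forall t, 0 <= t <= 1 -> \int[mu]_(u in I01) (after t u * h u) = 0) ->
  {ae mu, forall u, I01 u -> h u = 0}.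
Proof.
move=> ih h0.
pose H := h \_ I01.
have Hint : mu.-integrable setT (EFin \o H).
  by rewrite /H -restrict_EFin; apply/(integrable_mkcond _ (@mI01 R)).
have Hint' y : mu.-integrable `]-oo, y] (EFin \o H).
  by apply: integrableS Hint.
have Ih : \int[mu]_(u in I01) h u = 0.
  by rewrite -Int_after0// h0// lexx ler01.
have F0 y : \int[mu]_(t in `]-oo, y]) H t = 0.
  rewrite /H -Rintegral_mkcondr setIC Rintegral_mkcondr.
  rewrite (_ : Rintegral _ _ _ = \int[mu]_(u in I01) (h u - after y u * h u)).
    rewrite Int_B//; last exact: int01_after.
    rewrite Ih sub0r; apply/eqP; rewrite oppr_eq0; apply/eqP.
    have [y0|y0] := ltP y 0.
      rewrite -{2}Ih; apply: eq_Int => u; rewrite /= in_itv/= => /andP[u0 _].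
      by rewrite /after (lt_le_trans y0 u0) mul1r.
    have [y1|y1] := ltP 1 y; last by apply: h0; rewrite y0.
    rewrite -{2}(Int_cst (0 : R)); apply: eq_Int => u; rewrite /= in_itv/= => /andP[_ u1].
    by rewrite /after ltNge (ltW (le_lt_trans u1 y1)) mul0r.
  apply: eq_Int => u _; rewrite patchE mem_setE in_itv/= /after ltNge.
  by case: (u <= y); rewrite /= ?mul0r ?mul1r ?subr0 ?subrr.
have := FTC1Ny Hint' (integrable_locally (@mI01 R) ih).
apply: filterS; first exact: (ae_filter_ringOfSetsType mu).
move=> u [_ Hu] Iu.
have : H u = 0.
  rewrite -Hu (_ : (fun x => _) = cst 0); first by rewrite derive1_cst.
  by apply/funext => y; exact: F0.
by rewrite /H patchE mem_set.
Qed.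

(** By [weak_FTC] two weak derivatives have the same integrals over [t, 1], so they
agree almost everywhere. *)
Lemma weak_derivative_unique f g h : {within I01, continuous f} ->
  sqint01 g -> sqint01 h -> weak_derivative f g -> weak_derivative f h ->
  \int[mu]_(t in I01) (g t ^+ 2) = \int[mu]_(t in I01) (h t ^+ 2).
Proof.
move=> cf sg sh fg fh.
have ig := sqint01_int sg; have ih := sqint01_int sh.
have : {ae mu, forall u, I01 u -> g u - h u = 0}.
  apply: int01_after_inj; first exact: int01B.
  move=> t t01; under eq_Rintegral do rewrite mulrBr.
  rewrite Int_B; [|exact: int01_after..].
  by rewrite -(weak_FTC cf ig fg t01) -(weak_FTC cf ih fh t01) subrr.
move=> gh; rewrite /Rintegral; congr fine.
apply: ae_eq_integral => //.
- by have [] := (integrableP _ _ _ sg.2).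
- by have [] := (integrableP _ _ _ sh.2).
- move: gh; apply: filterS; first exact: (ae_filter_ringOfSetsType mu).
  by move=> u H Iu /=; rewrite (subr0_eq (H Iu)).
Qed.

Lemma eq_weak_derivative (f f' g g' : R -> R) : f =1 f' -> g =1 g' ->
  weak_derivative f g -> weak_derivative f' g'.
Proof. by move=> /funext-> /funext->. Qed.

Lemma weak_derivative_line a b : weak_derivative (fun t : R => a + t * b) (cst b).
Proof.
apply: weak_derivative_C1 => [t|]; last exact: cst_continuous.
by apply: is_derive_eq; rewrite /GRing.scale/= mulr0 !add0r mulr1 mul1r.
Qed.

Lemma cont_line (a b : R) : continuous (fun t : R => a + t * b).
Proof. by move=> t; apply: cvgD; [exact: cvg_cst|apply: cvgMl]. Qed.

(** The Green function with pole t of the second derivative on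
[0, 1] with Dirichlet conditions; its derivative takes only two values. *)
Definition green t u : R := kink t u - u * (1 - t).

Lemma continuous_green t : continuous (green t).
Proof.
move=> u; apply: cvgB; first exact: continuous_kink.
by apply: cvgMl.
Qed.

Lemma weak_derivative_green t : 0 <= t <= 1 ->
  weak_derivative (green t) (fun u => after t u - (1 - t)).
Proof.
move=> t01.
apply: (eq_weak_derivative (f := fun u => kink t u + (-1) * (0 + u * (1 - t)))
    (g := fun u => after t u + (-1) * (1 - t))).
- by move=> u; rewrite /green add0r mulN1r.
- by move=> u; rewrite mulN1r.
apply: (weak_derivativeDZ (g2 := cst (1 - t))).
- exact/continuous_subspaceT/continuous_kink.
- exact/continuous_subspaceT/cont_line.
- exact/sqint01_int/sqint01_after.
- exact: int01_cst.
- exact: weak_derivative_kink.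
- exact: weak_derivative_line.
Qed.

Lemma green_bc t : 0 <= t <= 1 -> green t 0 = 0 /\ green t 1 = 0.
Proof.
move=> /andP[t0 t1]; rewrite /green !kinkE mul0r mul1r sub0r subr0.
rewrite (max_idPl _) ?oppr_le0// (max_idPr _) ?subr_ge0// subrr.
done.
Qed.

Lemma green_bound t : exists2 G, 0 <= G & forall u, I01 u -> `|green t u| <= G.
Proof.
have [G HG] := bounded01 (continuous_subspaceT (continuous_green (t := t))).
exists G => //; apply: le_trans (HG 0 _) => //.
by rewrite /= in_itv/= lexx ler01.
Qed.

End WeakCalculus.

(** * Curves of class W^{1,2} and their action *)

Section Curves.
Context {R : realType} {n : nat}.
Notation mu := (@lebesgue_measure R).
Notation I01 := (`[0%R : R, 1%R]%classic).
Implicit Types (x y v w : R -> 'rV[R]_n) (tau : R).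

Lemma coord_le (y : 'rV[R]_n) i : `|y 0 i| <= `|y|.
Proof.
rewrite [leRHS]/Num.Def.normr/= mx_normrE.
exact: (le_bigmax _ _ (0, i)).
Qed.

Lemma norm_rV_le (y : 'rV[R]_n) (M : R) : 0 <= M ->
  (forall i, `|y 0 i| <= M) -> `|y| <= M.
Proof.
move=> M0 yM; rewrite [leLHS]/Num.Def.normr/= mx_normrE.
by apply: bigmax_le => // -[i j] _ /=; rewrite (ord1 i).
Qed.

Lemma norm_delta_le1 (i : 'I_n) : `|delta_mx 0 i : 'rV[R]_n| <= 1.
Proof.
apply: norm_rV_le => // j; rewrite !mxE.
by case: (_ && _); rewrite ?normr1 ?normr0.
Qed.

Lemma cvg_rVP {T : Type} (F : set_system T) (FF : Filter F) (f : T -> 'rV[R]_n) (y : 'rV[R]_n) :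
  f @ F --> y <-> forall i, (f t 0 i) @[t --> F] --> y 0 i.
Proof.
split=> [fy i|fy].
  apply/cvgrPdist_le => e e0; move/cvgrPdist_le : fy => /(_ e e0).
  apply: filterS => t; apply: le_trans.
  by have := coord_le (y - f t) i; rewrite !mxE.
apply/cvgrPdist_le => e e0.
have : \forall t \near F, forall i, `|y 0 i - f t 0 i| <= e.
  by apply: filter_forall => i; exact: ((cvgrPdist_le _ _).1 (fy i)).
apply: filterS => t yt; apply: norm_rV_le; first exact: ltW.
by move=> i; rewrite !mxE.
Qed.

Lemma coord_cont (A : set R) x i : {within A, continuous x} ->
  {within A, continuous (fun t => x t 0 i)}.
Proof.
move=> cx t; have /cvg_rVP := cx t; exact.
Qed.

Lemma cont_of_coords (A : set R) x : (forall i, {within A, continuous (fun t => x t 0 i)}) ->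
  {within A, continuous x}.
Proof. by move=> cx t; apply/cvg_rVP => i; exact: cx. Qed.

(** The Lagrangian with an arbitrary potential: what follows depends on U only
through its continuity, its partial derivatives and its upper bound. *)
Definition mechanical (U : 'rV[R]_n -> R) (y v : 'rV[R]_n) : R :=
  2^-1 * sqnorm v - U y.

Lemma comp_cont (U : 'rV[R]_n -> R) x : continuous U ->
  {within I01, continuous x} -> {within I01, continuous (fun t => U (x t))}.
Proof. by move=> cU cx t; apply: continuous_comp; [exact: cx|exact: cU]. Qed.

Lemma L2_weak_derivativeP x v : L2_weak_derivative x v <->
  forall i, sqint01 (fun t => v t 0 i) /\
    weak_derivative (fun t => x t 0 i) (fun t => v t 0 i).
Proof. by split=> H i; have [/L2_01P] := H i. Qed.

Lemma wderivP x : W12 x -> L2_weak_derivative x (wderiv x).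
Proof.
move=> [_ _ [v xv]]; rewrite /wderiv; case: xgetP => [w -> //|/(_ v)].
by case.
Qed.

Definition energy v : R := \sum_i \int[mu]_(t in I01) (v t 0 i ^+ 2).

Lemma energy_ge0 (v : R -> 'rV[R]_n) : 0 <= energy v.
Proof. by apply: sumr_ge0 => i _; apply: Rintegral_ge0 => t _; exact: sqr_ge0. Qed.

(** The action is defined with a chosen weak derivative; by uniqueness any other
one gives the same kinetic energy. *)
Lemma action_mechanical U tau x v : continuous U -> W12 x ->
  L2_weak_derivative x v ->
  action (mechanical U) tau x =
  tau * (2^-1 * (tau ^- 2 * energy v) - \int[mu]_(t in I01) U (x t)).
Proof.
move=> cU Wx xv; have [cx _ _] := Wx; congr (_ * _).
have xw := wderivP Wx; set w := wderiv x in xw *.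
have IU : int01 (fun t => U (x t)) by apply: int01_cont; exact: comp_cont.
have Iw i : int01 (fun t => w t 0 i ^+ 2).
  by have /L2_weak_derivativeP/(_ i)[[]] := xw.
transitivity (\int[mu]_(t in I01)
    (2^-1 * (tau ^- 2 * \sum_i w t 0 i ^+ 2) - U (x t))).
  apply: eq_Int => t _; rewrite /mechanical; congr (_ * _ - _).
  rewrite /sqnorm mulr_sumr; apply: eq_bigr => i _.
  by rewrite mxE exprMn exprVn.
have Is : int01 (fun t => \sum_i w t 0 i ^+ 2) by exact: int01_sum.
rewrite Int_B//; last by do 2 apply: int01Z.
rewrite Int_Z ?Int_Z//; last exact: int01Z.
rewrite Int_sum//; congr (_ * (_ * _) - _); apply: eq_bigr => i _.
have /L2_weak_derivativeP/(_ i)[sw ww] := xw.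
have /L2_weak_derivativeP/(_ i)[sv wv] := xv.
apply: weak_derivative_unique sw sv ww wv; exact: coord_cont.
Qed.

Lemma W12_of_L2_weak_derivative x v : {within I01, continuous x} -> L2_weak_derivative x v -> W12 x.
Proof.
move=> cx xv; split => //; last by exists v.
by move=> i; apply/L2_01P/sqint01_cont/coord_cont.
Qed.

Lemma W12_bc_nonempty (xm xp : 'rV[R]_n) : W12_bc xm xp (fun t => xm + t *: (xp - xm)).
Proof.
split; last by rewrite scale1r addrC subrK.
  apply: (@W12_of_L2_weak_derivative _ (cst (xp - xm))).
    apply: cont_of_coords => i; apply: continuous_subspaceT.
    by under eq_fun do rewrite !mxE; exact: cont_line.
  apply/L2_weak_derivativeP => i; split; first exact: sqint01_cst.
  have := @weak_derivative_line R (xm 0 i) ((xp - xm) 0 i).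
  congr weak_derivative; apply/funext => t; by rewrite !mxE.
by rewrite scale0r addr0.
Qed.

Definition vary x (e : R) t (i : 'I_n) : R -> 'rV[R]_n :=
  fun u => x u + (e * green t u) *: delta_mx 0 i.

Definition dvary v (e : R) t (i : 'I_n) : R -> 'rV[R]_n :=
  fun u => v u + (e * (after t u - (1 - t))) *: delta_mx 0 i.

Lemma vary_cont x e t i : {within I01, continuous x} ->
  {within I01, continuous (vary x e t i)}.
Proof.
move=> cx; apply: cont_of_coords => j u.
rewrite (_ : (fun u => _) = fun u => x u 0 j + e * green t u * (0 == 0 :> 'I_1)%:R * (j == i)%:R); last first.
  by apply/funext => {}u; rewrite !mxE; case: (j == i); rewrite /= ?andbF ?mulr1 ?mulr0.
apply: cvgD; first exact: coord_cont.
apply: (continuous_subspaceT (f := fun u => e * green t u * (0 == 0 :> 'I_1)%:R * (j == i)%:R)) => {}u.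
by apply: cvgMl; apply: cvgMl; apply: cvgMr; exact: continuous_green.
Qed.

Lemma vary_L2 x v e t i : 0 <= t <= 1 -> {within I01, continuous x} ->
  L2_weak_derivative x v -> L2_weak_derivative (vary x e t i) (dvary v e t i).
Proof.
move=> t01 cx /L2_weak_derivativeP xv; apply/L2_weak_derivativeP => j.
have [sv wv] := xv j.
have sg : sqint01 (fun u => after t u - (1 - t)).
  exact: sqint01D (sqint01_after t) (sqint01_cst (- (1 - t))).
split.
  have := sqint01D sv (sqint01Z (e * (j == i)%:R) sg); congr sqint01.
  by apply/funext => u; rewrite !mxE eqxx /=; ring.
apply: eq_weak_derivative (weak_derivativeDZ (e * (j == i)%:R) (coord_cont (i := j) cx)
  (continuous_subspaceT (continuous_green (t := t))) (sqint01_int sv) (sqint01_int sg) wv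
  (weak_derivative_green t01)) => u.
  by rewrite !mxE eqxx /=; ring.
by rewrite !mxE eqxx /=; ring.
Qed.

Lemma vary_bc xm xp x e t i : 0 <= t <= 1 -> W12_bc xm xp x ->
  W12_bc xm xp (vary x e t i).
Proof.
move=> t01 [Wx x0 x1]; have [cx _ _] := Wx; split.
- by apply: W12_of_L2_weak_derivative; [exact: vary_cont|apply: vary_L2 => //; exact: wderivP].
- by rewrite /vary (green_bc t01).1 mulr0 scale0r addr0.
- by rewrite /vary (green_bc t01).2 mulr0 scale0r addr0.
Qed.

End Curves.

(** * Increments of functions with continuous partial derivatives *)

Section Regular.
Context {R : realType} {n : nat}.
Notation mu := (@lebesgue_measure R).
Notation I01 := (`[0%R : R, 1%R]%classic).
Implicit Types (f : 'rV[R]_n -> R) (i : 'I_n).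

Lemma compact_ball (M : R) : compact [set y : 'rV[R]_n | `|y| <= M].
Proof.
apply: bounded_closed_compact.
  by exists M; split; rewrite ?num_real// => N MN y /= /le_trans; apply; exact: ltW.
apply: (@closed_comp _ _ (fun y : 'rV[R]_n => `|y|) [set r : R | r <= M]).
  by move=> y _; exact: norm_continuous.
exact: closed_le.
Qed.

Lemma ball_bounded f (M : R) : continuous f ->
  exists B : R, forall y, `|y| <= M -> `|f y| <= B.
Proof.
move=> cf.
have /compact_bounded[B [_ HB]] :=
  continuous_compact (continuous_subspaceT cf) (@compact_ball M).
exists (B + 1) => y yM; apply: HB; first by rewrite ltrDl.
by exists y.
Qed.

Lemma is_derive_line f i y (s : R) :
  (forall z, derivable f z (delta_mx 0 i)) ->
  is_derive s 1 (fun r : R => f (y + r *: delta_mx 0 i))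
    (partial i f (y + s *: delta_mx 0 i)).
Proof.
move=> df; have dfs := df (y + s *: delta_mx 0 i).
have E : (fun h : R => h^-1 *: (f (y + (h *: 1 + s) *: delta_mx 0 i) -
     f (y + s *: delta_mx 0 i))) =
  (fun h : R => h^-1 *: (f (h *: delta_mx 0 i + (y + s *: delta_mx 0 i)) -
     f (y + s *: delta_mx 0 i))).
  apply/funext => h; congr (_ *: (f _ - _)).
  have -> : h *: (1 : R) + s = h + s by rewrite /GRing.scale/= mulr1.
  by rewrite scalerDl addrCA.
by split; [rewrite /derivable E|rewrite /derive E].
Qed.

(** The mean value theorem along a coordinate line. *)
Lemma partial_incr f i y (h : R) :
  (forall z, derivable f z (delta_mx 0 i)) ->
  exists2 s : R, `|s| <= `|h| &
  f (y + h *: delta_mx 0 i) - f y = partial i f (y + s *: delta_mx 0 i) * h.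
Proof.
move=> df.
pose F (r : R) := f (y + r *: delta_mx 0 i).
pose dF (r : R) := partial i f (y + r *: delta_mx 0 i).
have dFF (r : R) : is_derive r 1 F (dF r) by exact: is_derive_line.
have cF := C1_cont dFF.
have F0 : F 0 = f y by rewrite /F scale0r addr0.
have [h0|h0] := leP 0 h.
  have [s] := @MVT_segment R F dF 0 h h0 (fun r _ => dFF r) (continuous_subspaceT cF).
  rewrite in_itv/= => /andP[s0 sh] E; exists s.
    by rewrite !ger0_norm.
  by rewrite -F0 -/(F h) E subr0.
have [s] := @MVT_segment R F dF h 0 (ltW h0) (fun r _ => dFF r) (continuous_subspaceT cF).
rewrite in_itv/= => /andP[hs s0] E; exists s.
  by rewrite !ler0_norm ?lerN2// ltW.
by rewrite -F0 -/(F h) -opprB E sub0r mulrN opprK.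
Qed.

End Regular.

(** * Global primitives *)

Section Primitive.
Context {R : realType}.
Notation mu := (@lebesgue_measure R).
Notation I01 := (`[0%R : R, 1%R]%classic).
Implicit Types f g : R -> R.

(** Extend by constants outside [0, 1] and multiply by a cutoff; the compact
support makes the extension integrable on the whole line. *)
Lemma extend01 g : {within I01, continuous g} -> exists gt : R -> R,
  [/\ continuous gt, (forall t, I01 t -> gt t = g t) &
      (forall t, t < -1 \/ 2 < t -> gt t = 0)].
Proof.
move=> cg.
pose cl (t : R) : R := Num.max 0 (Num.min 1 t).
have ccl : continuous cl.
  move=> t; apply: (@continuous_max R R (cst 0) (fun t => Num.min 1 t)).
    exact: cst_continuous.
  apply: (@continuous_min R R (cst 1) id); first exact: cst_continuous.
  exact: cvg_id.
have clI t : I01 (cl t).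
  rewrite /= in_itv/= /cl le_max lexx/=.
  by rewrite ge_max ler01 ge_min lexx.
have clE t : I01 t -> cl t = t.
  rewrite /= in_itv/= => /andP[t0 t1].
  by rewrite /cl (min_idPr t1) (max_idPr t0).
have cgc : continuous (fun t => g (cl t)).
  move=> t; apply/cvgrPdist_le => e e0.
  move/subspace_continuousP : cg => /(_ _ (clI t))/cvgrPdist_le/(_ e e0)[r /= r0 rg].
  have /cvgrPdist_lt/(_ r r0) := ccl t.
  by apply: filterS => s ts; apply: rg => //; exact: clI.
pose cut (t : R) : R := Num.max 0 (1 - `|t - cl t|).
have ccut : continuous cut.
  move=> t; apply: (@continuous_max R R (cst 0) (fun t => 1 - `|t - cl t|)).
    exact: cst_continuous.
  apply: cvgB; first exact: cvg_cst.
  by apply: cvg_norm; apply: cvgB => //; exact: ccl.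
exists (fun t => g (cl t) * cut t); split.
- by move=> t; apply: cvgM; [exact: cgc|exact: ccut].
- move=> t It; rewrite clE// /cut clE// subrr normr0 subr0.
  by rewrite (max_idPr _)// mulr1.
- move=> t tout; rewrite /cut (max_idPl _) ?mulr0// subr_le0 /cl.
  case: tout => t1.
    by rewrite (min_idPr _) ?(max_idPl _) ?subr0 ?ltr0_norm; lra.
  by rewrite (min_idPl _) ?(max_idPr _) ?gtr0_norm; lra.
Qed.

(** Integration from -oo makes the primitive differentiable at every real
number, with no exceptional base point. *)
Lemma primitive f : continuous f -> (forall t, t < -1 \/ 2 < t -> f t = 0) ->
  exists F : R -> R, forall t : R, is_derive t 1 F (f t).
Proof.
move=> cf f0.
have fE : f = f \_ `[-1, 2]%classic.
  apply/funext => t; rewrite patchE mem_setE in_itv/=.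
  case: ifPn => //; rewrite negb_and -!ltNge => /orP[h|h]; apply: f0; by [left|right].
have fint : mu.-integrable setT (EFin \o f).
  have mI : measurable (`[-1, 2]%classic : set (measurableTypeR R)) by exact: measurable_itv.
  rewrite fE -restrict_EFin; apply/(integrable_mkcond _ mI).
  apply: continuous_compact_integrable; first exact: segment_compact.
  exact: continuous_subspaceT.
exists (fun t => \int[mu]_(u in `]-oo, t]) f u) => t.
have [] := @continuous_FTC1 R f -oo%O t (t + 1).
- by rewrite ltrDl.
- by apply: integrableS fint.
- by rewrite ltNyr.
- exact: cf.
by move=> d; rewrite derive1E => <-; split.
Qed.

End Primitive.

(** * Limits of minimizing sequences *)

Section Minimizing.
Context {R : realType} {n : nat}.
Notation mu := (@lebesgue_measure R).
Notation I01 := (`[0%R : R, 1%R]%classic).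
Variables (U : 'rV[R]_n -> R) (xm xp : 'rV[R]_n) (tau m : R).
Hypothesis tau0 : 0 < tau.
Hypothesis cU : continuous U.
Hypothesis dU : forall i z, derivable U z (delta_mx 0 i).
Hypothesis cdU : forall i, continuous (partial i U).
Let A := action (mechanical U) tau.
Hypothesis mA : forall y, W12_bc xm xp y -> m <= A y.

Lemma cvg_Int_U (y_ : nat -> R -> 'rV[R]_n) y (M : R) :
  (forall k, {within I01, continuous (y_ k)}) ->
  (forall k t, I01 t -> `|y_ k t| <= M) ->
  (forall t, I01 t -> y_ k t @[k --> \oo] --> y t) ->
  \int[mu]_(t in I01) U (y_ k t) @[k --> \oo] --> \int[mu]_(t in I01) U (y t).
Proof.
move=> cy yM yy; have [B HB] := ball_bounded M cU.
have [||||_ //] := @Int_dominated _ (fun k t => U (y_ k t)) (fun t => U (y t)) (cst B).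
- by move=> k; apply: int01_meas; apply: int01_cont; exact: comp_cont.
- exact: int01_cst.
- by move=> k t It; apply: HB; exact: yM.
- by move=> t It; apply: (cvg_comp _ _ (yy t It)); exact: cU.
Qed.

Definition green_energy t : R := \int[mu]_(u in I01) ((after t u - (1 - t)) ^+ 2).

(** The integral of green t ' against the velocity of x, expressed by positions:
the affine interpolation of the end points minus x t. *)
Definition chord (x : R -> 'rV[R]_n) (t : R) (i : 'I_n) : R :=
  (x 1 0 i - x t 0 i) - (1 - t) * (x 1 0 i - x 0 0 i).

Lemma energy_dvary x v e t i : 0 <= t <= 1 -> {within I01, continuous x} ->
  L2_weak_derivative x v ->
  energy (dvary v e t i) = energy v + (2 * (e * chord x t i) + e ^+ 2 * green_energy t).
Proof.
move=> t01 cx /L2_weak_derivativeP xv.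
rewrite /energy (bigD1 i)//= [in RHS](bigD1 i)//=.
rewrite [X in _ + X = _](_ : _ = \sum_(j < n | j != i) \int[mu]_(t in I01) (v t 0 j ^+ 2)); last first.
  apply: eq_bigr => j ji; apply: eq_Int => u _.
  by rewrite !mxE (negbTE ji) mulr0 addr0.
rewrite [RHS]addrAC; congr (_ + _).
have [sv wv] := xv i.
have sg : sqint01 (fun u => after t u - (1 - t)).
  exact: sqint01D (sqint01_after t) (sqint01_cst (- (1 - t))).
have iv := sqint01_int sv.
have ivg := sqint01_mul sv sg.
transitivity (\int[mu]_(u in I01) (v u 0 i ^+ 2 +
   (2 * e * (v u 0 i * (after t u - (1 - t))) + e ^+ 2 * (after t u - (1 - t)) ^+ 2))).
  by apply: eq_Int => u _; rewrite !mxE !eqxx/=; ring.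
rewrite Int_D; [|exact: sv.2|]; last by apply: int01D; apply: int01Z => //; exact: sg.2.
rewrite Int_D; [|exact: int01Z|by apply: int01Z; exact: sg.2].
rewrite !Int_Z//; last exact: sg.2.
rewrite -/(green_energy t) (_ : \int[mu]_(u in I01) (v u 0 i * (after t u - (1 - t))) = chord x t i); first by ring.
transitivity (\int[mu]_(u in I01) (after t u * v u 0 i - (1 - t) * v u 0 i)).
  by apply: eq_Int => u _; ring.
rewrite Int_B; [|exact: int01_after|exact: int01Z].
have cxi := coord_cont (i := i) cx.
rewrite -(weak_FTC cxi iv wv t01) Int_Z// -(Int_after0 iv) -(weak_FTC cxi iv wv)//.
by rewrite lexx ler01.
Qed.

(** A minimizing sequence, if m is the infimum of the action; the constant
sequence equal to a minimizer is the other case of interest. *)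
Variables (x_ : nat -> R -> 'rV[R]_n) (x : R -> 'rV[R]_n) (M : R).
Hypothesis bx_ : forall k, W12_bc xm xp (x_ k).
Hypothesis Ax_ : A (x_ k) @[k --> \oo] --> m.
Hypothesis xx : forall t, I01 t -> x_ k t @[k --> \oo] --> x t.
Hypothesis x_M : forall k t, I01 t -> `|x_ k t| <= M.
Hypothesis cx : {within I01, continuous x}.

Let cx_ k : {within I01, continuous (x_ k)}.
Proof. by have [[]] := bx_ k. Qed.

Let I0 : I01 0. Proof. by rewrite /= in_itv/= lexx ler01. Qed.
Let I1 : I01 1. Proof. by rewrite /= in_itv/= lexx ler01. Qed.

Lemma lim_bc : x 0 = xm /\ x 1 = xp.
Proof.
split.
  apply: (cvg_unique (@norm_hausdorff _ _) (xx I0)).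
  rewrite (_ : (fun k => x_ k 0) = cst xm); first exact: cvg_cst.
  by apply/funext => k; have [] := bx_ k.
apply: (cvg_unique (@norm_hausdorff _ _) (xx I1)).
rewrite (_ : (fun k => x_ k 1) = cst xp); first exact: cvg_cst.
by apply/funext => k; have [] := bx_ k.
Qed.

Lemma lim_M t : I01 t -> `|x t| <= M.
Proof.
move=> It; apply: (cvgr_to_le (cvg_norm (xx It))).
by apply: nearW => k; exact: x_M.
Qed.

Lemma norm_vary (y : R -> 'rV[R]_n) (e t : R) (i : 'I_n) (G u : R) : `|green t u| <= G ->
  `|vary y e t i u| <= `|y u| + `|e| * G.
Proof.
move=> gG; apply: (le_trans (ler_normD _ _)); rewrite lerD2l normrZ normrM.
rewrite -mulrA ler_wpM2l//.
apply: le_trans gG.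
by rewrite ler_piMr ?norm_delta_le1.
Qed.

(** Compare each curve of the sequence with its variation by e green t in the i-th
coordinate.  The kinetic energies cancel except for terms in the positions at
0, t and 1 ([energy_dvary]), which converge. *)
Lemma variation_ge0 e t i : I01 t ->
  tau * (\int[mu]_(u in I01) U (vary x e t i u) - \int[mu]_(u in I01) U (x u)) <=
  tau^-1 * (e * chord x t i + 2^-1 * e ^+ 2 * green_energy t).
Proof.
move=> It; have t01 : 0 <= t <= 1 by move: It; rewrite /= in_itv.
have [G G0 HG] := green_bound t.
have L1 : chord (x_ k) t i @[k --> \oo] --> chord x t i.
  have c s : I01 s -> x_ k s 0 i @[k --> \oo] --> x s 0 i.
    by move=> Is; have /cvg_rVP := xx Is; exact.
  by apply: cvgB; [|apply: cvgMr]; apply: cvgB; exact: c.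
have L2 : \int[mu]_(u in I01) U (vary (x_ k) e t i u) @[k --> \oo] -->
    \int[mu]_(u in I01) U (vary x e t i u).
  apply: (@cvg_Int_U _ _ (M + `|e| * G)).
  - by move=> k; exact: vary_cont.
  - move=> k u Iu; apply: (le_trans (norm_vary _ _ _ (HG _ Iu))).
    by rewrite lerD2r x_M.
  - by move=> u Iu; apply: cvgD; [exact: xx|exact: cvg_cst].
have L3 := cvg_Int_U cx_ x_M xx.
have key k : tau * (\int[mu]_(u in I01) U (vary (x_ k) e t i u) -
     \int[mu]_(u in I01) U (x_ k u)) <=
  tau^-1 * (e * chord (x_ k) t i + 2^-1 * e ^+ 2 * green_energy t) + (A (x_ k) - m).
  have [Wx _ _] := bx_ k.
  have bv := vary_bc e i t01 (bx_ k); have [Wv _ _] := bv.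
  have xv := wderivP Wx.
  have := mA bv; rewrite /A.
  rewrite (action_mechanical _ cU Wv (vary_L2 e i t01 (@cx_ k) xv)).
  rewrite (action_mechanical _ cU Wx xv).
  rewrite (energy_dvary _ _ t01 (@cx_ k) xv).
  set E := energy _; set a := chord _ _ _; set c := green_energy _.
  set J := Rintegral _ _ _; set K := Rintegral _ _ _.
  have tn : tau != 0 by rewrite gt_eqF.
  have E1 : tau * (2^-1 * (tau ^- 2 * (E + (2 * (e * a) + e ^+ 2 * c))) - J) =
    tau * (2^-1 * (tau ^- 2 * E) - K) - tau * (J - K)
    + tau^-1 * (e * a + 2^-1 * e ^+ 2 * c) by field.
  rewrite E1; lra.
have R1 : (tau * (\int[mu]_(u in I01) U (vary (x_ k) e t i u) -
     \int[mu]_(u in I01) U (x_ k u))) @[k --> \oo] -->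
   tau * (\int[mu]_(u in I01) U (vary x e t i u) - \int[mu]_(u in I01) U (x u)).
  by apply: cvgMr; apply: cvgB.
have R2 : (tau^-1 * (e * chord (x_ k) t i + 2^-1 * e ^+ 2 * green_energy t) + (A (x_ k) - m)) @[k --> \oo]
   --> tau^-1 * (e * chord x t i + 2^-1 * e ^+ 2 * green_energy t) + (m - m).
  apply: cvgD; last by apply: cvgB => //; exact: cvg_cst.
  by apply: cvgMr; apply: cvgD; [exact: cvgMr|exact: cvg_cst].
rewrite subrr addr0 in R2.
by apply: (ler_cvg_to R1 R2); exact: nearW.
Qed.

(** Differentiation under the integral sign at e = 0, by [partial_incr] and
dominated convergence. *)
Lemma cvg_quotient (e_ : nat -> R) t i : (forall k, e_ k != 0) ->
  (forall k, `|e_ k| <= 1) -> e_ k @[k --> \oo] --> (0 : R) ->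
  (e_ k)^-1 * (\int[mu]_(u in I01) U (vary x (e_ k) t i u) -
     \int[mu]_(u in I01) U (x u)) @[k --> \oo] -->
  \int[mu]_(u in I01) (partial i U (x u) * green t u).
Proof.
move=> en0 e1 e0.
have [G G0 HG] := green_bound t.
have [B HB] := ball_bounded (M + G) (cdU (i := i)).
have cv k : {within I01, continuous (fun u => U (vary x (e_ k) t i u))}.
  by apply: comp_cont => //; exact: vary_cont.
have cUx : {within I01, continuous (fun u => U (x u))} by exact: comp_cont.
have E k : (e_ k)^-1 * (\int[mu]_(u in I01) U (vary x (e_ k) t i u) -
     \int[mu]_(u in I01) U (x u)) =
   \int[mu]_(u in I01) ((e_ k)^-1 * (U (vary x (e_ k) t i u) - U (x u))).
  rewrite Int_Z ?Int_B//; try exact: int01_cont.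
  by apply: int01B; exact: int01_cont.
rewrite (eq_cvg _ _ E).
have incr k u : exists2 s : R, `|s| <= `|e_ k * green t u| &
   (e_ k)^-1 * (U (vary x (e_ k) t i u) - U (x u)) =
   partial i U (x u + s *: delta_mx 0 i) * green t u.
  have [s s1 s2] := partial_incr (x u) (e_ k * green t u) (@dU i).
  by exists s => //; rewrite s2; field; exact: en0.
have dn1 := @norm_delta_le1 R n i.
have [||||_ //] := @Int_dominated _
  (fun k u => (e_ k)^-1 * (U (vary x (e_ k) t i u) - U (x u)))
  (fun u => partial i U (x u) * green t u) (cst (B * G)).
- move=> k; apply: int01_meas; apply: int01Z; apply: int01B; exact: int01_cont.
- exact: int01_cst.
- move=> k u Iu; have [s s1 ->] := incr k u.
  rewrite normrM /=; apply: ler_pM => //; last exact: HG.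
  apply: HB; apply: (le_trans (ler_normD _ _)); apply: lerD; first exact: lim_M.
  rewrite normrZ; apply: (@le_trans _ _ `|s|); first by rewrite ler_piMr.
  apply: (le_trans s1); rewrite normrM -[leRHS]mul1r.
  by apply: ler_pM => //; exact: HG.
- move=> u Iu; apply/cvgrPdist_le => d d0.
  have cz : {for x u, continuous (partial i U)} by exact: cdU.
  have dG : 0 < d / (G + 1) by rewrite divr_gt0//; lra.
  have /cvgrPdist_le/(_ _ dG)/nbhs_ballP[r /= r0 rH] := cz.
  have rG : 0 < r / (G + 1) by rewrite divr_gt0//; lra.
  have /cvgrPdist_lt/(_ _ rG) := e0.
  apply: filterS => k; rewrite sub0r normrN => ek.
  have [s s1 ->] := incr k u.
  have gG := HG u Iu.
  rewrite -mulrBl normrM.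
  have : `|partial i U (x u) - partial i U (x u + s *: delta_mx 0 i)| <= d / (G + 1).
    apply: rH; rewrite -ball_normE /ball_/= opprD addrA subrr sub0r normrN normrZ.
    apply: (@le_lt_trans _ _ `|s|); first by rewrite ler_piMr.
    apply: (le_lt_trans s1); rewrite normrM.
    move: ek; rewrite ltr_pdivlMr; last by lra.
    apply: le_lt_trans; rewrite ler_wpM2l//; lra.
  move=> H; apply: (@le_trans _ _ (d / (G + 1) * G)).
    by apply: ler_pM.
  rewrite mulrAC ler_pdivrMr; last by lra.
  by rewrite ler_wpM2l//; [exact: ltW|lra].
Qed.

(** [variation_ge0] is divided by e and e tends to 0 from both sides. *)
Lemma green_equation t i : I01 t ->
  \int[mu]_(u in I01) (partial i U (x u) * green t u) = tau ^- 2 * chord x t i.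
Proof.
move=> It.
set J := \int[mu]_(u in I01) _.
pose D e := \int[mu]_(u in I01) U (vary x e t i u) - \int[mu]_(u in I01) U (x u).
have tn : tau != 0 by rewrite gt_eqF.
have h0 k : 0 < (k.+1%:R : R)^-1 by rewrite invr_gt0 ltr0n.
have h1 k : `|(k.+1%:R : R)^-1| <= 1 by rewrite gtr0_norm// invf_le1 ?ler1n ?ltr0n.
have Lp := @cvg_quotient (fun k => k.+1%:R^-1) t i (fun k => lt0r_neq0 (h0 k)) h1 (@cvg_harmonic R).
have Ln := @cvg_quotient (fun k => - k.+1%:R^-1) t i.
have {}Ln : (- k.+1%:R^-1)^-1 * D (- k.+1%:R^-1) @[k --> \oo] --> J.
  apply: Ln.
  - by move=> k; rewrite oppr_eq0 lt0r_neq0.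
  - by move=> k; rewrite normrN.
  - by rewrite -oppr0; apply: cvgN; exact: cvg_harmonic.
(* the quadratic term of the variation contributes e times a constant *)
have C1 c : (tau ^- 2 * (chord x t i + c * k.+1%:R^-1)) @[k --> \oo] --> tau ^- 2 * chord x t i.
  have h : (chord x t i + c * k.+1%:R^-1) @[k --> \oo] --> chord x t i + c * 0.
    by apply: cvgD; [exact: cvg_cst|apply: cvgMr; exact: cvg_harmonic].
  by rewrite mulr0 addr0 in h; exact: cvgMr.
apply/eqP; rewrite eq_le; apply/andP; split.
  apply: (ler_cvg_to Lp (C1 (2^-1 * green_energy t))); apply: nearW => k.
  have := variation_ge0 (k.+1%:R^-1) i It; rewrite -/(D _).
  have := h0 k; set e := k.+1%:R^-1 => e0 H.
  rewrite -(ler_pM2l e0) mulrA divff ?gt_eqF// mul1r -(ler_pM2l tau0).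
  apply: (le_trans H); rewrite le_eqVlt; apply/orP; left; apply/eqP.
  by field.
apply: (ler_cvg_to (C1 (- (2^-1 * green_energy t))) Ln); apply: nearW => k.
have := variation_ge0 (- k.+1%:R^-1) i It; rewrite -/(D _).
have := h0 k; set e := k.+1%:R^-1 => e0 H.
have E : e * ((- e)^-1 * D (- e)) = - D (- e).
  by field; rewrite gt_eqF.
rewrite -(ler_pM2l e0) E -(ler_pM2l tau0).
rewrite -lerN2 mulrN opprK.
apply: (le_trans H); rewrite le_eqVlt; apply/orP; left; apply/eqP.
by field.
Qed.

Lemma cvg_sumr (f_ : 'I_n -> nat -> R) (l : 'I_n -> R) :
  (forall i, f_ i k @[k --> \oo] --> l i) ->
  \sum_i f_ i k @[k --> \oo] --> \sum_i l i.
Proof.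
move=> fl; apply: cvg_big; first exact: add_continuous.
by move=> i _; exact: fl.
Qed.

(** [green_equation] expresses x t by primitives of g and of u g u, where
g u = partial_i U (x u).  The terms t g t cancel in the first derivative, which is
therefore again differentiable.  X, p and q are position, velocity and
acceleration, defined on the whole line. *)
Lemma limit_solves_newton i : exists X p q : R -> R,
  [/\ (forall t : R, is_derive t 1 X (p t)), (forall t : R, is_derive t 1 p (q t)),
      continuous q, (forall t, I01 t -> x t 0 i = X t) &
      forall t, I01 t -> q t = - tau ^+ 2 * partial i U (x t)].
Proof.
have cg : {within I01, continuous (fun t => partial i U (x t))} by exact: comp_cont.
have [g [cgt gE g0]] := extend01 cg.
have [G dG] := primitive cgt g0.
have cug : continuous (fun u : R => u * g u).
  by move=> u; apply: cvgM; [exact: cvg_id|exact: cgt].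
have ug0 t : t < -1 \/ 2 < t -> t * g t = 0 by move=> /g0->; rewrite mulr0.
have [H dH] := primitive cug ug0.
have tn : tau != 0 by rewrite gt_eqF.
(* D and d come from the affine part u (1 - t) of green t *)
pose D := \int[mu]_(u in I01) (u * g u).
pose d := x 1 0 i - x 0 0 i.
exists (fun t => x 1 0 i - d * (1 - t) - tau ^+ 2 * ((H 1 - H t) - t * (G 1 - G t) - D * (1 - t))).
exists (fun t => d - tau ^+ 2 * (D - (G 1 - G t))).
exists (fun t => - tau ^+ 2 * g t); split.
- move=> t; have dGt := dG t; have dHt := dH t.
  by apply: is_derive_eq; rewrite /GRing.scale/=; ring.
- move=> t; have dGt := dG t.
  by apply: is_derive_eq; rewrite /GRing.scale/=; ring.
- by move=> t; apply: cvgMr; exact: cgt.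
- move=> t It; have t01 : 0 <= t <= 1 by move: It; rewrite /= in_itv.
  have ig := int01_contT cgt; have iug := int01_contT cug.
  have FG := weak_FTC (continuous_subspaceT (C1_cont dG)) ig (weak_derivative_C1 dG cgt) t01.
  have FH := weak_FTC (continuous_subspaceT (C1_cont dH)) iug (weak_derivative_C1 dH cug) t01.
  have := green_equation i It.
  rewrite (_ : Rintegral _ _ _ = \int[mu]_(u in I01)
     (after t u * (u * g u) - t * (after t u * g u) - (1 - t) * (u * g u))); last first.
    by apply: eq_Int => u Iu; rewrite /green /kink gE//; ring.
  rewrite Int_B; [|apply: int01B|exact: int01Z]; first last.
  - by apply: int01Z; exact: int01_after.
  - exact: int01_after.
  rewrite Int_B; [|exact: int01_after|by apply: int01Z; exact: int01_after].
  rewrite !Int_Z//; last exact: int01_after.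
  rewrite -FG -FH -/D /chord -/d => E.
  have {}E : x 1 0 i - x t 0 i - (1 - t) * d =
    tau ^+ 2 * (H 1 - H t - t * (G 1 - G t) - (1 - t) * D).
    by rewrite E; field.
  by lra.
- by move=> t It; rewrite gE.
Qed.

(** Lower semicontinuity: with p the velocity of x, the action of the k-th curve is
at least [low k], in which the velocity v enters linearly, through int v p.  As p
is of class C^1, integration by parts turns int v p into an integral of the
position, and [low k] tends to the action of x. *)
Lemma limit_minimizer : minimizer_on (W12_bc xm xp) A x.
Proof.
have [x0E x1E] := lim_bc.
have /choice[X HX] := limit_solves_newton; have /choice[p Hp] := HX; have /choice[q Hq] := Hp.
pose w t : 'rV[R]_n := \row_i p i t.
have cp i : continuous (p i) by have [_ dp _ _ _] := Hq i; exact: C1_cont dp.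
have icp i : {within I01, continuous (p i)} by exact: continuous_subspaceT.
have wx i : weak_derivative (fun t => x t 0 i) (p i).
  have [dX _ _ XE _] := Hq i.
  move=> phi tphi; rewrite -(weak_derivative_C1 dX (cp i) tphi).
  by apply: eq_Int => t It; rewrite XE.
have xw : L2_weak_derivative x w.
  apply/L2_weak_derivativeP => i; split.
    by have := sqint01_cont (icp i); congr sqint01; apply/funext => t; rewrite mxE.
  by apply: eq_weak_derivative (wx i) => t //; rewrite mxE.
have Wx : W12 x by exact: W12_of_L2_weak_derivative xw.
split; first by split.
suff AxM : A x <= m by move=> y /mA; exact: le_trans.
have tn : tau != 0 by rewrite gt_eqF.
have Ew : energy w = \sum_i \int[mu]_(t in I01) (p i t * p i t).
  by apply: eq_bigr => i _; apply: eq_Int => t _; rewrite mxE.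
have IP k i : \int[mu]_(t in I01) (wderiv (x_ k) t 0 i * p i t) =
   xp 0 i * p i 1 - xm 0 i * p i 0 - \int[mu]_(t in I01) (x_ k t 0 i * q i t).
  have [dX dp cq _ _] := Hq i; have [Wk xk0 xk1] := bx_ k.
  have /L2_weak_derivativeP/(_ i)[sv wv] := wderivP Wk.
  rewrite (weak_by_parts (coord_cont (i := i) (@cx_ k)) (sqint01_int sv) wv dp cq).
  by rewrite xk0 xk1.
have C i : \int[mu]_(t in I01) (wderiv (x_ k) t 0 i * p i t) @[k --> \oo] -->
    \int[mu]_(t in I01) (p i t * p i t).
  have [dX dp cq _ _] := Hq i.
  rewrite (eq_cvg _ _ (fun k => IP k i)).
  rewrite (weak_by_parts (coord_cont (i := i) cx) (int01_cont (icp i)) (wx i) dp cq).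
  rewrite x0E x1E; apply: cvgB; first exact: cvg_cst.
  have [B HB] := bounded01 (continuous_subspaceT cq).
  have [||||_ //] := @Int_dominated _ (fun k t => x_ k t 0 i * q i t)
    (fun t => x t 0 i * q i t) (cst (M * B)).
  - move=> k; apply: int01_meas; apply: int01_contM => //.
    by apply: coord_cont; exact: cx_.
  - exact: int01_cst.
  - move=> k t It; rewrite normrM ler_pM// ?HB//.
    by apply: le_trans (coord_le _ _) _; exact: x_M.
  - move=> t It; apply: cvgMl.
    by have /cvg_rVP := xx It; exact.
pose low k := tau * (2^-1 * (tau ^- 2 * \sum_i
   (2 * \int[mu]_(t in I01) (wderiv (x_ k) t 0 i * p i t) -
    \int[mu]_(t in I01) (p i t * p i t))) - \int[mu]_(t in I01) U (x_ k t)).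
have lowA k : low k <= A (x_ k).
  have [Wk _ _] := bx_ k; have xv := wderivP Wk.
  rewrite /A (action_mechanical _ cU Wk xv) /low ler_pM2l// lerD2r.
  rewrite ler_pM2l ?invr_gt0// ler_pM2l ?exprn_gt0 ?invr_gt0 ?exprn_gt0//.
  apply: ler_sum => i _; have /L2_weak_derivativeP/(_ i)[sv wv] := xv.
  have sp := sqint01_cont (icp i).
  have ivp := sqint01_mul sv sp; have ipp := sqint01_mul sp sp.
  rewrite -Int_Z// -Int_B//; last exact: int01Z.
  apply: le_Int; [by apply: int01B => //; exact: int01Z|exact: sv.2|].
  by move=> t _; have := sqr_ge0 (wderiv (x_ k) t 0 i - p i t); nra.
have lowC : low k @[k --> \oo] --> A x.
  rewrite /A (action_mechanical _ cU Wx xw) Ew.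
  apply: cvgMr; apply: cvgB; last exact: (cvg_Int_U cx_ x_M xx).
  do 2 apply: cvgMr.
  rewrite (_ : \sum_i _ = \sum_i (2 * \int[mu]_(t in I01) (p i t * p i t) -
    \int[mu]_(t in I01) (p i t * p i t))); last first.
    by apply: eq_bigr => i _; ring.
  apply: cvg_sumr => i; apply: cvgB; last exact: cvg_cst.
  by apply: cvgMr; exact: C.
by apply: (ler_cvg_to lowC Ax_); exact: nearW.
Qed.

End Minimizing.

(** * Existence of minimizers *)

Section Compactness.
Context {R : realType}.

(** A cluster point of an image of an ultrafilter is a limit. *)
Lemma ultra_cvg_compact {T : Type} {X : topologicalType} (F : set_system T)
    (f : T -> X) (K : set X) : UltraFilter F -> compact K ->
  (forall k, K (f k)) -> exists2 p, K p & f @ F --> p.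
Proof.
move=> UF cK fK.
have [p [Kp clp]] : K `&` cluster (f @ F) !=set0.
  by apply: cK; exact: (@filterE T F _ _ fK).
exists p => // B Bp.
have [//|FB] := in_ultra_setVsetC (f @^-1` B) UF.
have [q []] := clp (~` B) B FB Bp.
by [].
Qed.

End Compactness.

Section Existence.
Context {R : realType} {n : nat}.
Notation mu := (@lebesgue_measure R).
Notation I01 := (`[0%R : R, 1%R]%classic).
Variables (U : 'rV[R]_n -> R) (xm xp : 'rV[R]_n) (tau K : R).
Hypothesis tau0 : 0 < tau.
Hypothesis cU : continuous U.
Hypothesis dU : forall i z, derivable U z (delta_mx 0 i).
Hypothesis cdU : forall i, continuous (partial i U).
Hypothesis UK : forall y, U y <= K.
Let A := action (mechanical U) tau.

Lemma action_coercive y : W12 y ->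
  tau^-1 * (2^-1 * energy (wderiv y)) - tau * K <= A y.
Proof.
move=> Wy; have [cy _ _] := Wy.
rewrite /A (action_mechanical _ cU Wy (wderivP Wy)).
have H : \int[mu]_(t in I01) U (y t) <= K.
  rewrite -[leRHS](Int_cst K); apply: le_Int.
  - by apply: int01_cont; exact: comp_cont.
  - exact: int01_cst.
  - by move=> t _; exact: UK.
set E := energy _.
have tn : tau != 0 by rewrite gt_eqF.
rewrite [leRHS](_ : _ = tau^-1 * (2^-1 * E) - tau * \int[mu]_(t in I01) U (y t)); last by field.
by rewrite lerD2l lerN2 ler_pM2l.
Qed.

Lemma minimizing_sequence : exists (m : R) (y_ : nat -> R -> 'rV[R]_n),
  [/\ forall y, W12_bc xm xp y -> m <= A y,
      forall k, W12_bc xm xp (y_ k) &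
      forall k, A (y_ k) <= m + k.+1%:R^-1].
Proof.
pose S := [set A y | y in W12_bc xm xp].
have Slb : lbound S (- (tau * K)).
  move=> _ [y [Wy _ _] <-]; apply: le_trans (action_coercive Wy).
  rewrite lerDr; apply: mulr_ge0; first by rewrite invr_ge0 ltW.
  by apply: mulr_ge0; [rewrite invr_ge0|exact: energy_ge0].
have Sinf : has_inf S.
  split; last by exists (- (tau * K)).
  by exists (A (fun t => xm + t *: (xp - xm))), (fun t => xm + t *: (xp - xm)) => //; exact: W12_bc_nonempty.
have ex k : exists y, W12_bc xm xp y /\ A y <= inf S + k.+1%:R^-1.
  have k0 : 0 < (k.+1%:R : R)^-1 by rewrite invr_gt0 ltr0n.
  have [_ [y Wy <-] Hy] := inf_adherent k0 Sinf.
  by exists y; split => //; exact: ltW.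
have /choice[y_ Hy] := ex.
exists (inf S), y_; split.
- by move=> y Wy; apply: ge_inf; [case: Sinf|exists y].
- by move=> k; case: (Hy k).
- by move=> k; case: (Hy k).
Qed.

Lemma Int_after1 s t : 0 <= s -> s <= t -> t <= 1 ->
  \int[mu]_(u in I01) (after s u - after t u) = t - s.
Proof.
move=> s0 st t1.
have d1 (u : R) : is_derive u (1 : R) (fun u : R => u) 1 by exact: is_derive_id.
have c1 : continuous (cst 1 : R -> R) by move=> ?; exact: cvg_cst.
have F r := weak_FTC (continuous_subspaceT (C1_cont d1)) (int01_contT c1) (weak_derivative_C1 d1 c1) (t := r).
have Fs := F s; have Ft := F t.
rewrite Int_B; try by apply: sqint01_int; exact: sqint01_after.
have E r : \int[mu]_(u in I01) (after r u * 1) = \int[mu]_(u in I01) (after r u).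
  by apply: eq_Int => u _; rewrite mulr1.
rewrite -!E -Fs; last by rewrite s0 (le_trans st).
by rewrite -Ft ?(le_trans s0)//; ring.
Qed.

(** Young's inequality with a weight lam, 2 |g| <= lam + g^2 / lam, integrated
over [s, t]; choosing lam large and then t - s small makes the bound small. *)
Lemma weak_derivative_modulus (f g : R -> R) (E lam s t : R) : {within I01, continuous f} ->
  sqint01 g -> weak_derivative f g -> 0 < lam ->
  \int[mu]_(u in I01) (g u ^+ 2) <= E ->
  0 <= s -> s <= t -> t <= 1 ->
  `|f t - f s| <= 2^-1 * (lam * (t - s) + lam^-1 * E).
Proof.
move=> cf sg fg l0 gE s0 st t1.
have ig := sqint01_int sg.
have ia r : int01 (@after R r) by apply: sqint01_int; exact: sqint01_after.
have -> : f t - f s = \int[mu]_(u in I01) ((after s u - after t u) * g u).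
  rewrite (_ : Rintegral _ _ _ =
      \int[mu]_(u in I01) (after s u * g u - after t u * g u)); last first.
    by apply: eq_Int => u _; rewrite mulrBl.
  rewrite Int_B; [|exact: int01_after..].
  rewrite -(weak_FTC cf ig fg); last by rewrite s0 (le_trans st).
  by rewrite -(weak_FTC cf ig fg) ?(le_trans s0)//; ring.
have iag : int01 (fun u => (after s u - after t u) * g u).
  apply: eq_int01 (int01B (int01_after s ig) (int01_after t ig)) => u _.
  by rewrite mulrBl.
apply: (le_trans (Int_abs iag)).
apply: (@le_trans _ _ (\int[mu]_(u in I01)
   (2^-1 * (lam * (after s u - after t u) + lam^-1 * g u ^+ 2)))).
  apply: le_Int.
  - exact: int01_abs.
  - apply: int01Z; apply: int01D; apply: int01Z; first exact: int01B.
    exact: sg.2.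
  move=> u _.
  have ab : after s u - after t u = (s < u <= t)%R%:R.
    rewrite /after [in RHS]leNgt; case: (ltP s u) => su /=; case: (ltP t u) => tu /=; rewrite ?subrr ?subr0//.
    by have := lt_le_trans tu su; rewrite ltNge st.
  rewrite ab; case: (_ && _); last first.
    rewrite mul0r normr0 mulr0 add0r mulr_ge0 ?invr_ge0//.
    by rewrite mulr_ge0 ?invr_ge0 ?sqr_ge0// ltW.
  rewrite mul1r mulr1 -(@ler_pM2l _ (2 * lam)); last by lra.
  rewrite [leRHS](_ : _ = lam ^+ 2 + `|g u| ^+ 2); last first.
    by rewrite real_normK ?num_real//; field; rewrite gt_eqF.
  by have := sqr_ge0 (lam - `|g u|); nra.
rewrite Int_Z; last first.
  by apply: int01D; apply: int01Z; [exact: int01B|exact: sg.2].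
rewrite Int_D; [|by apply: int01Z; exact: int01B|by apply: int01Z; exact: sg.2].
rewrite !Int_Z; [|exact: sg.2|exact: int01B].
rewrite Int_after1// ler_pM2l ?invr_gt0// lerD2l ler_pM2l ?invr_gt0//.
Qed.

Lemma energy_modulus (y : R -> 'rV[R]_n) (E lam s t : R) : W12 y -> energy (wderiv y) <= E -> 0 < lam ->
  I01 s -> I01 t ->
  `|y t - y s| <= 2^-1 * (lam * `|t - s| + lam^-1 * E).
Proof.
move=> Wy yE l0; wlog st : s t / s <= t.
  move=> H Is It; have [st|/ltW ts] := leP s t; first exact: H.
  by rewrite distrC [`|t - s|]distrC; exact: H.
rewrite /= !in_itv/= => /andP[s0 s1] /andP[t0 t1].
have [cy _ _] := Wy.
have E0 : 0 <= E := le_trans (energy_ge0 _) yE.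
rewrite [`|t - s|]ger0_norm ?subr_ge0//.
apply: norm_rV_le.
  by rewrite mulr_ge0 ?invr_ge0// addr_ge0// mulr_ge0 ?invr_ge0 ?subr_ge0// ltW.
move=> i; rewrite !mxE.
have /L2_weak_derivativeP/(_ i)[sv wv] := wderivP Wy.
apply: weak_derivative_modulus sv wv _ _ _ _ _ => //; first exact: coord_cont.
apply: le_trans yE; rewrite /energy (bigD1 i)//= lerDl.
by apply: sumr_ge0 => j _; apply: Rintegral_ge0 => u _; exact: sqr_ge0.
Qed.

(** A minimizing sequence is equicontinuous and has values in a compact ball.
Along an ultrafilter it converges at each time; by equicontinuity and compactness
of [0, 1] the convergence is uniform, so a genuine subsequence can be extracted,
to which [limit_minimizer] applies. *)
Lemma action_minimizer_exists : exists x, minimizer_on (W12_bc xm xp) A x.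
Proof.
have [m [y_ [mA Wy Ay]]] := minimizing_sequence.
have W k : W12 (y_ k) by have [] := Wy k.
pose E0 := 2 * tau * (m + 1 + tau * K).
have EE k : energy (wderiv (y_ k)) <= E0.
  have := action_coercive (W k); have := Ay k.
  have : (k.+1%:R : R)^-1 <= 1 by rewrite invf_le1 ?ler1n ?ltr0n.
  set e := energy _; set a := A _; set h := k.+1%:R^-1 => h1 h2 h3.
  have : tau^-1 * (2^-1 * e) <= m + 1 + tau * K by lra.
  move=> h4; rewrite (_ : e = 2 * tau * (tau^-1 * (2^-1 * e))); last by field; rewrite gt_eqF.
  by rewrite /E0 ler_pM2l// mulr_gt0.
pose E := `|E0| + 1.
have Ep : 0 < E by rewrite /E ltr_pwDr.
have {}EE k : energy (wderiv (y_ k)) <= E.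
  by apply: le_trans (EE k) _; rewrite /E (le_trans (ler_norm _))// lerDl.
have eqc (e : R) : 0 < e -> exists2 d : R, 0 < d & forall k s t, I01 s -> I01 t ->
    `|t - s| < d -> `|y_ k t - y_ k s| <= e.
  (* the weight E / e makes the second term of the modulus e / 2 *)
  move=> e0; have l0 : 0 < E / e by rewrite divr_gt0.
  exists (e / (E / e)); first by rewrite divr_gt0.
  move=> k s t Is It ts.
  apply: (le_trans (energy_modulus (W k) (EE k) l0 Is It)).
  move: ts; rewrite ltr_pdivlMr// mulrC => ts.
  have -> : (E / e)^-1 * E = e by field; rewrite !gt_eqF.
  lra.
pose M := `|xm| + 2^-1 * (1 + E).
have I0 : I01 0 by rewrite /= in_itv/= lexx ler01.
have yM k t : I01 t -> `|y_ k t| <= M.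
  move=> It; have [_ y0 _] := Wy k.
  have := energy_modulus (W k) (EE k) ltr01 I0 It.
  rewrite y0 invr1 !mul1r subr0 => H.
  rewrite -[y_ k t](subrK xm) /M [leRHS]addrC.
  apply: (le_trans (ler_normD _ _)); rewrite lerD2r.
  apply: (le_trans H); rewrite ler_pM2l ?invr_gt0// lerD2r.
  by move: It; rewrite /= in_itv/= => /andP[t0 t1]; rewrite ger0_norm.
have [F [UF Foo]] := ultraFilterLemma eventually_filter.
have FF : ProperFilter F := @ultra_proper _ _ UF.
have cptM : compact [set z : 'rV[R]_n | `|z| <= M].
  exact: compact_ball.
have ptw t : exists z : 'rV[R]_n, I01 t -> y_ k t @[k --> F] --> z.
  have [It|nIt] := pselect (I01 t); last by exists 0.
  have [z _ Hz] := ultra_cvg_compact (f := fun k => y_ k t) UF cptM (fun k => yM k t It).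
  by exists z.
have /choice[x Hx] := ptw.
have xmod (e : R) : 0 < e -> exists2 d : R, 0 < d & forall s t, I01 s -> I01 t ->
    `|t - s| < d -> `|x t - x s| <= e.
  move=> e0; have [d d0 Hd] := eqc e e0; exists d => // s t Is It ts.
  apply: (cvgr_to_le (cvg_norm (cvgB (Hx t It) (Hx s Is)))).
  by apply: nearW => k; exact: Hd.
have cx : {within I01, continuous x}.
  apply/subspace_continuousP => s Is; apply/cvgrPdist_le => e e0.
  have [d d0 Hd] := xmod e e0.
  by exists d => // t /= ts It; apply: Hd.
have unif (e : R) : 0 < e -> \forall k \near F, forall t, I01 t -> `|y_ k t - x t| <= e.
  move=> e0; have e3 : 0 < e / 3 by rewrite divr_gt0.
  have [d1 d10 H1] := eqc _ e3; have [d2 d20 H2] := xmod _ e3.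
  have /compact_near_coveringP cpt := @segment_compact R 0 1.
  suff : \forall k \near F, I01 `<=` (fun t => I01 t -> `|y_ k t - x t| <= e).
    by apply: filterS => k Hk t It; exact: Hk.
  apply: (cpt nat F (fun k t => I01 t -> `|y_ k t - x t| <= e)) => s Is.
  have N1 : \forall t \near s, `|s - t| < Num.min d1 d2.
    by apply: nbhsx_ballx; rewrite lt_min d10.
  have N2 : \forall k \near F, `|x s - y_ k s| <= e / 3.
    by have /cvgrPdist_le/(_ _ e3) := Hx s Is.
  exists ([set t | `|s - t| < Num.min d1 d2], [set k | `|x s - y_ k s| <= e / 3]); first by split.
  move=> [t k] [/= N1t N2k] It.
  move: N1t; rewrite lt_min => /andP[ts1 ts2].
  rewrite -(subrKA (y_ k s)) -(subrKA (x s) (y_ k s)).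
  have a1 := H1 k s t Is It; rewrite distrC in ts1.
  have a2 := H2 t s It Is ts2.
  apply: (le_trans (ler_normD _ _)); rewrite (_ : e = e / 3 + (e / 3 + e / 3)); last by field.
  apply: lerD; first exact: a1.
  apply: (le_trans (ler_normD _ _)); apply: lerD => //.
  by rewrite distrC.
have sub j : exists k, (j <= k)%N /\ forall t, I01 t -> `|y_ k t - x t| <= j.+1%:R^-1.
  have j0 : 0 < (j.+1%:R : R)^-1 by rewrite invr_gt0 ltr0n.
  have G1 : F [set k | (j <= k)%N] by apply: Foo; exists j.
  have [k []] := @filter_ex _ F _ _ (filterI G1 (unif _ j0)).
  by exists k.
have /choice[phi Hphi] := sub.
exists x; apply: (@limit_minimizer _ _ U xm xp tau m tau0 cU dU cdU mA (fun j => y_ (phi j)) x M) => //.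
- apply/cvgrPdist_le => e e0.
  have /cvgrPdist_le/(_ _ e0) := @cvg_harmonic R.
  apply: filterS => j; rewrite sub0r normrN gtr0_norm ?invr_gt0 ?ltr0n// => je.
  rewrite distrC ger0_norm ?subr_ge0 ?mA//.
  apply: le_trans je; rewrite lerBlDl; apply: (le_trans (Ay _)).
  rewrite lerD2l lef_pV2 ?posrE ?ltr0n// ler_nat ltnS.
  by case: (Hphi j).
- move=> t It; apply/cvgrPdist_le => e e0.
  have /cvgrPdist_le/(_ _ e0) := @cvg_harmonic R.
  apply: filterS => j; rewrite sub0r normrN gtr0_norm ?invr_gt0 ?ltr0n// => je.
  by apply: le_trans je; rewrite distrC; apply: (Hphi j).2.
- by move=> j t It; exact: yM.
Qed.

End Existence.

(** * Regularity of the potential *)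

Section Potential.
Context {R : realType} {n : nat}.
Implicit Types (V : 'rV[R]_n -> R) (i j : 'I_n) (z : 'rV[R]_n).

Lemma class_CS k V i : class_C k.+1 V ->
  (forall z, derivable V z (delta_mx 0 i)) /\ class_C k (partial i V).
Proof. by move=> [_ /(_ i)]. Qed.

Lemma class_C_cont k V : class_C k V -> continuous V.
Proof. by case: k => [|k] // []. Qed.

Lemma potentialE (sigma : R) V : potentialU sigma V =
  fun z => sigma * (\sum_(j < n) partial j (partial j V) z)
    - 2^-1 * \sum_(j < n) partial j V z ^+ 2.
Proof.
apply/funext => z; congr (_ - _ * _); apply: eq_bigr => j _.
by rewrite mxE.
Qed.

Lemma continuous_sum_rV (f : 'I_n -> 'rV[R]_n -> R) :
  (forall j, continuous (f j)) -> continuous (fun z => \sum_j f j z).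
Proof.
move=> cf z; apply: (@cvg_big _ _ _ _ _ _ _ (nbhs z)); first exact: add_continuous.
by move=> j _; exact: cf.
Qed.

Lemma is_derive_partial (f : 'rV[R]_n -> R) i z :
  derivable f z (delta_mx 0 i) ->
  is_derive z (delta_mx 0 i) f (partial i f z).
Proof. exact: derivableP. Qed.

Lemma is_derive_sumr (f : 'I_n -> 'rV[R]_n -> R) (z v : 'rV[R]_n) (df : 'I_n -> R) :
  (forall j, is_derive z v (f j) (df j)) ->
  is_derive z v (fun y => \sum_j f j y) (\sum_j df j).
Proof.
move=> dfj; rewrite (_ : (fun y => _) = \sum_j f j); first exact: is_derive_sum.
by apply/funext => y; rewrite fct_sumE.
Qed.

(** The partial derivatives of U are polynomials in the derivatives of V of order
at most three. *)
Lemma potential_regular (sigma : R) V : class_C 4 V ->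
  [/\ continuous (potentialU sigma V),
      forall i z, derivable (potentialU sigma V) z (delta_mx 0 i) &
      forall i, continuous (partial i (potentialU sigma V))].
Proof.
move=> C4.
have d1 j := (class_CS j C4).2.
have d2 i j := class_CS i (d1 j).
have d3 i j := class_CS i (d2 j j).2.
have c1 j : continuous (partial j V) := class_C_cont (d1 j).
have c2 i j : continuous (partial i (partial j V)) := class_C_cont (d2 i j).2.
have c3 i j : continuous (partial i (partial j (partial j V))) := class_C_cont (d3 i j).2.
have dU i z : is_derive z (delta_mx 0 i) (potentialU sigma V)
    (sigma * (\sum_(j < n) partial i (partial j (partial j V)) z)
     - \sum_(j < n) partial j V z * partial i (partial j V) z).
  have e3 j := is_derive_partial ((d3 i j).1 z).
  have e2 j := is_derive_partial ((d2 i j).1 z).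
  have DA := is_derive_sumr e3.
  have DB := is_derive_sumr (fun j => is_deriveM (e2 j) (e2 j)).
  rewrite potentialE.
  apply: (is_derive_eq (is_deriveB (@is_deriveZ _ _ _ _ sigma _ _ _ DA)
     (@is_deriveZ _ _ _ _ 2^-1 _ _ _ DB))).
  rewrite /GRing.scale/= mulr_sumr; congr (_ - _); rewrite mulr_sumr.
  by apply: eq_bigr => j _; field.
split.
- have k1 : continuous (fun z => \sum_(j < n) partial j (partial j V) z).
    by apply: continuous_sum_rV => j; exact: c2.
  have k2 : continuous (fun z => \sum_(j < n) partial j V z ^+ 2).
    by apply: (@continuous_sum_rV (fun j z => partial j V z ^+ 2)) => j z; apply: continuousM; exact: c1.
  have k3 : continuous ((fun z => sigma * \sum_(j < n) partial j (partial j V) z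
      - 2^-1 * \sum_(j < n) partial j V z ^+ 2) : 'rV[R]_n -> R).
    by move=> z; apply: (@cvgB _ _ _ (nbhs z));
      [exact: (cvgMr (k1 z))|exact: (cvgMr (k2 z))].
  by rewrite potentialE.
- by move=> i z; have [] := dU i z.
- move=> i; rewrite (_ : partial i _ = fun z =>
    (sigma * (\sum_(j < n) partial i (partial j (partial j V)) z)
     - \sum_(j < n) partial j V z * partial i (partial j V) z)); last first.
    by apply/funext => z; have [_ <-] := dU i z.
  have k1 : continuous (fun z => \sum_(j < n) partial i (partial j (partial j V)) z).
    by apply: continuous_sum_rV => j; exact: c3.
  have k2 : continuous (fun z => \sum_(j < n) partial j V z * partial i (partial j V) z).
    apply: (@continuous_sum_rV (fun j z => partial j V z * partial i (partial j V) z)) => j z.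
    by apply: continuousM; [exact: c1|exact: c2].
  by move=> z; apply: (@cvgB _ _ _ (nbhs z)); [exact: (cvgMr (k1 z))|exact: k2].
Qed.

End Potential.

(** * The Euler-Lagrange equation *)

Section EulerLagrange.
Context {R : realType} {n : nat}.
Notation I01 := (`[0%R : R, 1%R]%classic).
Variables (U : 'rV[R]_n -> R).
Hypothesis dU : forall i z, derivable U z (delta_mx 0 i).

Lemma partial_x_mechanical y v : partial_x (mechanical U) y v = - grad U y.
Proof.
apply/rowP => i; rewrite !mxE /partial.
have dUi : is_derive y (delta_mx 0 i) U (partial i U y) by exact: is_derive_partial.
have [_ <-] : is_derive y (delta_mx 0 i) (fun z => mechanical U z v) (- partial i U y).
  rewrite /mechanical.
  have -> : (fun z => 2^-1 * sqnorm v - U z) = cst (2^-1 * sqnorm v) - U by [].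
  by apply: is_derive_eq; rewrite sub0r.
by [].
Qed.

(** The gradient of one half of the squared Euclidean norm is the identity. *)
Lemma partial_v_mechanical y w : partial_v (mechanical U) y w = w.
Proof.
apply/rowP => i; rewrite !mxE /partial /derive.
have H : (fun h : R => h^-1 *: (mechanical U y (h *: delta_mx 0 i + w) -
   mechanical U y w)) @ 0^' --> w 0 i.
  apply: (@cvg_trans _ ((fun h : R => w 0 i + 2^-1 * h) @ 0^')); last first.
    have H : (fun h : R => w 0 i + 2^-1 * h) @ 0^' --> w 0 i + 2^-1 * 0.
      apply: cvgD; first exact: cvg_cst.
      by apply: cvgMr; apply: cvg_within.
    by rewrite mulr0 addr0 in H.
  apply: near_eq_cvg; near=> h.
  have h0 : h != 0 by near: h; exact: nbhs_dnbhs_neq.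
  rewrite /mechanical /sqnorm (bigD1 i)//= [in X in _ - X](bigD1 i)//=.
  rewrite !mxE !eqxx/=.
  rewrite [X in _ *: (2^-1 * (_ + X) - _ - _)](_ : _ = \sum_(j < n | j != i) w 0 j ^+ 2).
    by rewrite /GRing.scale/=; field.
  by apply: eq_bigr => j ji; rewrite !mxE (negbTE ji) /= mulr0 add0r.
exact: (cvg_lim _ H).
Unshelve. all: by end_near. Qed.

(** For the mechanical Lagrangian the momentum is the velocity itself, and on
]0, 1[ the curve coincides with functions that are twice differentiable. *)
Lemma newton_euler_lagrange (x : R -> 'rV[R]_n) tau : 0 < tau ->
  (forall i, exists X p q : R -> R,
    [/\ (forall t : R, is_derive t 1 X (p t)), (forall t : R, is_derive t 1 p (q t)),
      continuous q, (forall t, I01 t -> x t 0 i = X t) &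
      forall t, I01 t -> q t = - tau ^+ 2 * partial i U (x t)]) ->
  euler_lagrange (mechanical U) tau x.
Proof.
move=> tau0 H.
have /choice[X HX] := H; have /choice[p Hp] := HX; have /choice[q Hq] := Hp.
have nearI (t : R) : 0 < t < 1 -> \forall s \near t, 0 < s < 1.
  move=> t01; near=> s; apply/andP; split; near: s.
    by apply: lt_nbhsr; case/andP : t01.
  by apply: lt_nbhsl; case/andP : t01.
have II (s : R) : 0 < s < 1 -> I01 s.
  by move=> /andP[s0 s1]; rewrite /= in_itv/= !ltW.
have dx (t : R) i : 0 < t < 1 -> is_derive t 1 (fun s => x s 0 i) (p i t).
  move=> t01; have [dX _ _ XE _] := Hq i.
  apply: near_eq_is_derive (dX t).
  by near=> s; rewrite XE//; apply: II; near: s; exact: nearI.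
have derx (t : R) : 0 < t < 1 -> derivable x t 1.
  move=> t01; apply/derivable_mxP => i j; rewrite (ord1 i).
  by have [] := dx t j t01.
have x'E (t : R) : 0 < t < 1 -> derive1 x t = \row_i p i t.
  move=> t01; rewrite derive1E derive_mx; last exact: derx.
  by apply/rowP => i; rewrite !mxE; have [_ <-] := dx t i t01.
move=> t t01; split; first exact: derx.
have dw : is_derive t (1 : R) (fun s => \row_i (tau^-1 * p i s) : 'rV[R]_n) (\row_i (tau^-1 * q i t)).
  have dp i : is_derive t (1 : R) (fun s => tau^-1 * p i s) (tau^-1 * q i t).
    have [_ dp _ _ _] := Hq i; have dpt := dp t.
    by apply: is_derive_eq; rewrite /GRing.scale/=; ring.
  have D : derivable (fun s => \row_i (tau^-1 * p i s) : 'rV[R]_n) t 1.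
    apply/derivable_mxP => i j; under eq_fun do rewrite mxE.
    by have [] := dp j.
  split => //; rewrite derive_mx//; apply/rowP => i; rewrite !mxE.
  by under eq_fun do rewrite mxE; have [_ <-] := dp i.
rewrite (_ : tau *: _ = \row_i (tau^-1 * q i t)).
  apply: near_eq_is_derive dw; near=> s.
  rewrite partial_v_mechanical x'E; last by near: s; exact: nearI.
  by apply/rowP => i; rewrite !mxE.
apply/rowP => i; rewrite partial_x_mechanical !mxE.
have [_ _ _ _ qE] := Hq i; rewrite qE; last exact: II.
by field; rewrite gt_eqF.
Unshelve. all: by end_near. Qed.

(** [limit_solves_newton] for the constant sequence equal to the minimizer. *)
Lemma minimizer_euler_lagrange (xm xp : 'rV[R]_n) tau x : 0 < tau ->
  continuous U -> (forall i, continuous (partial i U)) ->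
  minimizer_on (W12_bc xm xp) (action (mechanical U) tau) x ->
  euler_lagrange (mechanical U) tau x.
Proof.
move=> tau0 cU cdU [Wx mx].
have [[cx _ _] _ _] := Wx.
have cnx : {within I01, continuous (fun t => `|x t|)}.
  by move=> t; apply: cvg_norm; exact: cx.
have [M HM] := bounded01 cnx.
apply: newton_euler_lagrange => // i.
apply: (@limit_solves_newton _ _ U xm xp tau _ tau0 cU dU cdU mx (fun=> x) x M) => //.
- exact: cvg_cst.
- by move=> t _; exact: cvg_cst.
- by move=> k t It; rewrite -[leLHS]normr_id HM.
Qed.

End EulerLagrange.

Theorem theorem2p7 (R : realType) (n : nat) (sigma : R) (V : 'rV[R]_n -> R)
    (hsigma : 0 < sigma)
    (hC4 : class_C 4 V)
    (hUbounded : has_ubound (range (potentialU sigma V)))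
    (hUmax : exists2 D, bounded_domain D & max_points (potentialU sigma V) `<=` D)
    (x0 x1 : 'rV[R]_n)
    (hx01 : x0 <> x1)
    (hmin0 : local_minimizer V x0) (hmin1 : local_minimizer V x1)
    (hgrad0 : grad V x0 = 0) (hgrad1 : grad V x1 = 0)
    (hlap0 : 0 < laplacian V x0) (hlap1 : 0 < laplacian V x1)
    (xm xp : 'rV[R]_n) (tau : R) (htau : 0 < tau) :
  let L := lagrangian sigma V in
  (exists x : R -> 'rV[R]_n, minimizer_on (W12_bc xm xp) (action L tau) x) /\
  (forall x : R -> 'rV[R]_n, minimizer_on (W12_bc xm xp) (action L tau) x ->
     euler_lagrange L tau x).
Proof.
have [cU dU cdU] := potential_regular sigma hC4.
have [K HK] := hUbounded.
have -> : lagrangian sigma V = mechanical (potentialU sigma V) by [].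
split.
  apply: (@action_minimizer_exists _ _ _ xm xp tau K htau cU dU cdU) => y.
  by apply: HK; exists y.
by move=> x; exact: minimizer_euler_lagrange.
Qed.
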